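(* Let $(N,h)$ be a Riemannian manifold and let $\delta_1,\delta_2\in\mathbb{R}$ with $\delta_1,\delta_2\neq0$. Let $\phi\in W^{2,2}_{loc}(\mathbb{R}^m,N)\cap L^\infty_{loc}(\mathbb{R}^m,N)$ be a stationary solution of $$\delta_2\bar\Delta\tau(\phi)=\delta_2R^N(d\phi(e_j),\tau(\phi))d\phi(e_j)+\delta_1\tau(\phi).$$ Moreover, suppose that $$\int_{\mathbb{R}^m}\big(|d\phi|^2+|\bar\nabla d\phi|^2\big)\,dV<\infty.$$ Then: 1. If $m=1$ and $\delta_1,\delta_2>0$, then $\phi$ is trivial (i.e. constant). 2. If $m=2$ and $\delta_2>0$, then $\phi$ is harmonic. 3. If $m=3$ and $\delta_1<0$, $\delta_2>0$, then $\phi$ is trivial. 4. If $m=4$ and $\delta_1<0$, then $\phi$ is trivial. 5. If $m\geq5$ and $\delta_1,\delta_2<0$, then $\phi$ is trivial.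
   Context: For $\phi\colon(M,g)\to(N,h)$, $\bar\nabla$ denotes the induced connection on $\phi^\ast TN$ (and on $T^*M\otimes\phi^*TN$), $\tau(\phi)=\operatorname{Tr}_g\bar\nabla d\phi$ the tension field, $\bar\Delta=\operatorname{Tr}(\bar\nabla\bar\nabla)$ the connection Laplacian on $\phi^\ast TN$, $R^N(X,Y)Z=[\nabla_X,\nabla_Y]Z-\nabla_{[X,Y]}Z$ the curvature tensor of $N$, and $\{e_j\}$ a (local) orthonormal basis of $TM$; repeated indices are summed. $\phi$ is harmonic if $\tau(\phi)=0$. The equation is the Euler–Lagrange equation of $$E_{\delta_1,\delta_2}(\phi)=\delta_1\int_M|d\phi|^2\,dV+\delta_2\int_M|\tau(\phi)|^2\,dV.$$ Sobolev maps into $N$ are understood via an isometric embedding $N\subset\mathbb{R}^q$, with $\bar\nabla d\phi$ the projection of the weak second derivatives onto $T_\phi N$, and the equation is understood in the sense of distributions. The stress-energy tensor is $$S_{ij}=\delta_1\big(2\langle d\phi(e_i),d\phi(e_j)\rangle-g_{ij}|d\phi|^2\big)+\delta_2\big(-|\tau(\phi)|^2+2\nabla_{e_k}\langle d\phi(e_k),\tau(\phi)\rangle\big)g_{ij}-2\delta_2\big(\langle d\phi(e_i),\bar\nabla_{e_j}\tau(\phi)\rangle+\langle d\phi(e_j),\bar\nabla_{e_i}\tau(\phi)\rangle\big).$$ A solution $\phi\in W^{2,2}_{loc}(M,N)\cap L^\infty_{loc}(M,N)$ is called stationary if it is also a critical point of $E_{\delta_1,\delta_2}$ with respect to variations of the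 metric on the domain, that is $$0=\int_Mk^{ij}S_{ij}\,dV$$ for smooth (compactly supported) symmetric 2-tensors $k_{ij}$. Here terms involving derivatives of $\tau(\phi)$ are understood distributionally, i.e. by integrating by parts: $\int k^{ij}\langle d\phi(e_i),\bar\nabla_{e_j}\tau(\phi)\rangle dV:=-\int(\nabla_{e_j}k^{ij})\langle d\phi(e_i),\tau(\phi)\rangle dV-\int k^{ij}\langle(\bar\nabla_{e_j}d\phi)(e_i),\tau(\phi)\rangle dV$ and $\int k^{ij}g_{ij}\nabla_{e_k}\langle d\phi(e_k),\tau(\phi)\rangle dV:=-\int\nabla_{e_k}(k^{ij}g_{ij})\langle d\phi(e_k),\tau(\phi)\rangle dV$. *)

(* Defs.v *)
From HB Require Import structures.
From mathcomp Require Import all_boot all_order all_algebra.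
From mathcomp Require Import all_classical all_reals all_analysis.

Set Implicit Arguments.
Unset Strict Implicit.
Unset Printing Implicit Defensive.

Import Order.TTheory GRing.Theory Num.Theory.
Import numFieldNormedType.Exports.

Local Open Scope classical_set_scope.
Local Open Scope ring_scope.

Definition rV_display : measure_display.
Proof. exact: (measure_tuple_display default_measure_display). Qed.

(* The sigma-algebra generated by the coordinates, i.e. the Borel sets. *)
Section measurable_rV.
Variables (R : realType) (n : nat).

Definition rV_coord (i : 'I_n) (v : 'rV[R]_n) : measurableTypeR R := v ord0 i.

Let rV_set0 : g_sigma_preimage rV_coord set0.
Proof. exact: sigma_algebra0. Qed.

Let rV_setC A : g_sigma_preimage rV_coord A -> g_sigma_preimage rV_coord (~` A).
Proof. exact: sigma_algebraC. Qed.

Let rV_bigcup (F : _^nat) : (forall i, g_sigma_preimage rV_coord (F i)) ->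
  g_sigma_preimage rV_coord (\bigcup_i (F i)).
Proof. exact: sigma_algebra_bigcup. Qed.

HB.instance Definition _ := @isMeasurable.Build rV_display
  'rV[R]_n (g_sigma_preimage rV_coord) rV_set0 rV_setC rV_bigcup.

End measurable_rV.

Lemma measurable_rV_coord (R : realType) n (i : 'I_n) :
  measurable_fun [set: 'rV[R]_n] (rV_coord i).
Proof.
move=> _ Y mY; rewrite setTI; apply: sub_sigma_algebra => /=.
rewrite -bigcup_seq/=; exists i => /=; first by rewrite mem_index_enum.
by exists Y => //; rewrite setTI.
Qed.

Lemma measurable_rVP (R : realType) n d (T : measurableType d)
    (f : T -> 'rV[R]_n) :
  (forall i, measurable_fun [set: T] (rV_coord i \o f)) ->
  measurable_fun [set: T] f.
Proof.
move=> mf.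
suff H : g_sigma_preimage (fun i => rV_coord i \o f) `<=` measurable.
  move=> _ A mA; apply: H; rewrite g_sigma_preimage_comp.
  by exists A.
apply: smallest_sub; first exact: sigma_algebra_measurable.
case: n => [|n] in f mf *; first by rewrite big_ord0.
rewrite -bigcup_mkord_ord; apply: bigcup_sub => i Ii.
by move=> A [B mB <-]; exact: mf.
Qed.

Section lebesgue_rV.
Variable R : realType.

Definition rV_cons n (p : measurableTypeR R * 'rV[R]_n) : 'rV[R]_n.+1 :=
  \row_i oapp (p.2 ord0) (p.1 : R) (unlift ord0 i).

Definition rV_uncons n (v : 'rV[R]_n.+1) : measurableTypeR R * 'rV[R]_n :=
  (v ord0 ord0, \row_i v ord0 (lift ord0 i)).

Lemma rV_cons0 n p : @rV_cons n p ord0 ord0 = p.1.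
Proof. by rewrite mxE unlift_none. Qed.

Lemma rV_consS n p j : @rV_cons n p ord0 (lift ord0 j) = p.2 ord0 j.
Proof. by rewrite mxE liftK. Qed.

Lemma rV_consK n : cancel (@rV_cons n) (@rV_uncons n).
Proof.
move=> [a v]; rewrite /rV_uncons rV_cons0/=; congr pair.
by apply/rowP => i; rewrite mxE rV_consS.
Qed.

Lemma measurable_rV_cons n : measurable_fun setT (@rV_cons n).
Proof.
apply: measurable_rVP => i; have [j ->|->] := unliftP ord0 i; last first.
  rewrite (_ : _ \o _ = fst); first exact: measurable_fst.
  by apply/funext => p; rewrite /rV_coord/= rV_cons0.
rewrite (_ : _ \o _ = rV_coord j \o snd).
  by apply: measurableT_comp => //; exact: measurable_rV_coord.
by apply/funext => p; rewrite /rV_coord/= rV_consS.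
Qed.

Lemma measurable_rV_uncons n : measurable_fun setT (@rV_uncons n).
Proof.
apply/measurable_fun_pairP; split; first exact: (measurable_rV_coord ord0).
apply: measurable_rVP => i.
rewrite (_ : _ \o _ = rV_coord (lift ord0 i)); first exact: measurable_rV_coord.
by apply/funext => v; rewrite /rV_coord/= mxE.
Qed.

Section lebesgue_rV_step.
Variables (n : nat) (mu : {sigma_finite_measure set 'rV[R]_n -> \bar R}).

Definition lebesgue_rV_step : set 'rV[R]_n.+1 -> \bar R :=
  pushforward (@lebesgue_measure R \x mu)%E (@rV_cons n).

Let step0 : lebesgue_rV_step set0 = 0%E.
Proof. by rewrite /lebesgue_rV_step /pushforward preimage_set0 measure0. Qed.

Let step_ge0 A : (0 <= lebesgue_rV_step A)%E.
Proof. by rewrite /lebesgue_rV_step /pushforward measure_ge0. Qed.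

Let step_sigma_additive : semi_sigma_additive lebesgue_rV_step.
Proof.
move=> F mF tF mUF; rewrite /lebesgue_rV_step /pushforward preimage_bigcup.
have mc A : measurable A -> measurable (@rV_cons n @^-1` A).
  by move=> mA; rewrite -[X in measurable X]setTI; exact: measurable_rV_cons.
apply: measure_semi_sigma_additive => [k||]; first exact: mc.
  apply/trivIsetP => i j _ _ ij; rewrite -preimage_setI.
  by move/trivIsetP : tF => /(_ _ _ _ _ ij) ->//; rewrite preimage_set0.
by rewrite -preimage_bigcup; exact: mc.
Qed.

HB.instance Definition _ := isMeasure.Build _ _ _ lebesgue_rV_step
  step0 step_ge0 step_sigma_additive.

Let step_sigma_finite : sigma_finite setT lebesgue_rV_step.
Proof.
have /sigma_finiteP[F [FT ndF Foo]] := sigma_finiteT (@lebesgue_measure R).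
have /sigma_finiteP[G [GT ndG Goo]] := sigma_finiteT mu.
exists (fun k => @rV_uncons n @^-1` (F k `*` G k)).
  rewrite -preimage_bigcup -[LHS](preimage_setT (@rV_uncons n)).
  congr (_ @^-1` _); rewrite -setXTT FT GT predeqE => -[x y]; split.
    move=> [/= [i _ Fx] [j _ Gy]]; exists (maxn i j) => //; split.
    - by move: x Fx; exact/subsetPset/ndF/leq_maxl.
    - by move: y Gy; exact/subsetPset/ndG/leq_maxr.
  by move=> [k _ []/= ? ?]; split; exists k.
move=> k; have [mF Fk] := Foo k; have [mG Gk] := Goo k; split.
  by rewrite -[X in measurable X]setTI; apply: measurable_rV_uncons => //;
     exact: measurableX.
rewrite /lebesgue_rV_step /pushforward -comp_preimage.
rewrite (_ : _ \o _ = id); last by apply/funext => p /=; rewrite rV_consK.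
by rewrite preimage_id product_measure1E// lte_mul_pinfty// ge0_fin_numE.
Qed.

HB.instance Definition _ := Measure_isSigmaFinite.Build _ _ _ lebesgue_rV_step
  step_sigma_finite.
End lebesgue_rV_step.

Fixpoint lebesgue_rV n : {sigma_finite_measure set 'rV[R]_n -> \bar R} :=
  match n with
  | 0%N => [the {sigma_finite_measure set 'rV[R]_0 -> \bar R} of
      @dirac _ 'rV[R]_0 0 R]
  | k.+1 => [the {sigma_finite_measure set 'rV[R]_k.+1 -> \bar R} of
             lebesgue_rV_step (lebesgue_rV k)]
  end.

End lebesgue_rV.

Lemma measurable_rV_box (R : realType) n (A : 'I_n -> set (measurableTypeR R)) :
  (forall i, measurable (A i)) ->
  measurable [set v : 'rV[R]_n | forall i, A i (v ord0 i)].
Proof.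
move=> mA.
rewrite [X in measurable X](_ : _ = \big[setI/setT]_(i < n) (@rV_coord R n i @^-1` A i)).
  apply: bigsetI_measurable => i _; rewrite -[X in measurable X]setTI.
  exact: measurable_rV_coord.
rewrite -bigcap_seq; apply/seteqP; split => [v Av i _|v H i]; first exact: Av.
by apply: (H i); rewrite /= mem_index_enum.
Qed.
Lemma lebesgue_rV_box (R : realType) n (A : 'I_n -> set (measurableTypeR R)) :
  (forall i, measurable (A i)) ->
  lebesgue_rV R n [set v | forall i, A i (v ord0 i)]
  = \big[*%E/1%E]_(i < n) lebesgue_measure (A i).
Proof.
elim: n A => [|n IH] A mA.
  rewrite big_ord0 /= diracE mem_set//.
  by move=> [].
rewrite big_ord_recl -IH // -product_measure1E//; last exact: (@measurable_rV_box R n (fun i => A (lift ord0 i))).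
rewrite /= /lebesgue_rV_step /pushforward; congr (_ _).
apply/seteqP; split => [p Ap|p [A0 Ap] i].
  split => [|i]; first by have := Ap ord0; rewrite rV_cons0.
  by have := Ap (lift ord0 i); rewrite rV_consS.
have [j ->|->] := unliftP ord0 i; first by rewrite rV_consS; exact: Ap.
by rewrite rV_cons0.
Qed.

Section calculus.
Variable R : realType.

Definition dotv q (u v : 'rV[R]_q) : R := \sum_c u ord0 c * v ord0 c.

Definition pder m (W : normedModType R) (i : 'I_m) (f : 'rV[R]_m -> W) :
    'rV[R]_m -> W :=
  fun x => 'D_(delta_mx ord0 i) f x.

Definition pders m (W : normedModType R) (s : seq 'I_m) (f : 'rV[R]_m -> W) :=
  foldr (@pder m W) f s.

(* To be used with U open: all iterated partial derivatives exist and are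
   continuous on U, that is, f is of class C^oo on U. *)
Definition smooth_on m (W : normedModType R) (U : set 'rV[R]_m)
    (f : 'rV[R]_m -> W) :=
  forall (s : seq 'I_m) (x : 'rV[R]_m), U x ->
    {for x, continuous (pders s f)} /\
    forall i : 'I_m, derivable (pders s f) x (delta_mx ord0 i).

Definition test_function m (eta : 'rV[R]_m -> R) :=
  smooth_on setT (eta : 'rV[R]_m -> R^o) /\
  compact (closure [set x | eta x != 0]).

End calculus.

Section submanifold.
Variables (R : realType) (q : nat).
Implicit Types (N : set 'rV[R]_q) (p : 'rV[R]_q).

(* Slice charts: near each of its points, N is mapped by a diffeomorphism of
   open sets of R^q onto an open piece of R^n x {0}. The Riemannian metric of N
   is the one induced by the Euclidean inner product of R^q. *)
Definition embedded_submanifold (n : nat) N :=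
  (n <= q)%N /\
  forall p, N p -> exists (U V : set 'rV[R]_q) (Phi Psi : 'rV[R]_q -> 'rV[R]_q),
    [/\ open U /\ U p, open V,
        smooth_on U Phi /\ (forall x, U x -> V (Phi x) /\ Psi (Phi x) = x),
        smooth_on V Psi /\ (forall y, V y -> U (Psi y) /\ Phi (Psi y) = y) &
        forall x, U x ->
          (N x <-> forall c : 'I_q, (n <= c)%N -> Phi x ord0 c = 0)].

Definition curve_in N p (v : 'rV[R]_q) (gamma : R^o -> 'rV[R]_q) :=
  [/\ gamma 0 = p, \forall t \near (0 : R^o), N (gamma t) &
      is_derive (0 : R^o) (1 : R^o) gamma v].

Definition tangent N p : set 'rV[R]_q :=
  [set v | exists gamma, curve_in N p v gamma].

(* Orthogonal projection of R^q onto T_p N, acting on row vectors by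
   right multiplication. *)
Definition tproj N p : 'M[R]_q :=
  get [set P : 'M[R]_q | forall v : 'rV[R]_q,
    tangent N p (v *m P) /\
    forall w, tangent N p w -> dotv (v - v *m P) w = 0].

(* Derivative at p, in the direction v \in T_p N, of a map that only matters
   on N. *)
Definition tderive N (f : 'rV[R]_q -> 'rV[R]_q) p (v : 'rV[R]_q) : 'rV[R]_q :=
  get [set w | exists gamma, curve_in N p v gamma /\
    is_derive (0 : R^o) (1 : R^o) (f \o gamma) w].

Definition vector_field N (X : 'rV[R]_q -> 'rV[R]_q) :=
  forall p, N p -> tangent N p (X p) /\
    exists (U : set 'rV[R]_q) (Y : 'rV[R]_q -> 'rV[R]_q),
      [/\ open U, U p, smooth_on U Y & forall x, U x -> N x -> X x = Y x].

(* Levi-Civita connection of the induced metric. *)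
Definition cov_der N (X Y : 'rV[R]_q -> 'rV[R]_q) : 'rV[R]_q -> 'rV[R]_q :=
  fun p => tderive N Y p (X p) *m tproj N p.

Definition lie_bracket N (X Y : 'rV[R]_q -> 'rV[R]_q) :
    'rV[R]_q -> 'rV[R]_q :=
  fun p => tderive N Y p (X p) - tderive N X p (Y p).

(* curvature N p x y z is R^N(x, y) z at p. *)
Definition curvature N p (x y z : 'rV[R]_q) : 'rV[R]_q :=
  get [set w | exists X Y Z : 'rV[R]_q -> 'rV[R]_q,
    [/\ vector_field N X /\ X p = x, vector_field N Y /\ Y p = y,
        vector_field N Z /\ Z p = z &
        w = cov_der N X (cov_der N Y Z) p - cov_der N Y (cov_der N X Z) p
            - cov_der N (lie_bracket N X Y) Z p]].

End submanifold.

Section sobolev.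
Variables (R : realType) (m : nat).
Notation mu := (@lebesgue_rV R m).
Implicit Types f g : 'rV[R]_m -> R.

Definition loc_integrable f :=
  measurable_fun setT f /\
  forall K : set 'rV[R]_m, compact K -> (\int[mu]_(x in K) `|f x|%:E < +oo)%E.

Definition L2_loc f :=
  measurable_fun setT f /\
  forall K : set 'rV[R]_m, compact K -> (\int[mu]_(x in K) (f x ^+ 2)%:E < +oo)%E.

Definition is_weak_pder (i : 'I_m) f g :=
  [/\ loc_integrable f, loc_integrable g &
      forall eta, test_function eta ->
        \int[mu]_x (f x * pder i (eta : 'rV[R]_m -> R^o) x)
        = - \int[mu]_x (g x * eta x)].

Definition wpder (i : 'I_m) f : 'rV[R]_m -> R := get (is_weak_pder i f).

Fixpoint Wk2_loc (k : nat) f : Prop :=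
  L2_loc f /\
  if k is k'.+1 then
    forall i, (exists g, is_weak_pder i f g) /\ Wk2_loc k' (wpder i f)
  else True.

Variable q : nat.
Implicit Types F : 'rV[R]_m -> 'rV[R]_q.

Definition wD (i : 'I_m) F : 'rV[R]_m -> 'rV[R]_q :=
  fun x => \row_c wpder i (fun y => F y ord0 c) x.

Definition Wk2_loc_vec (k : nat) F := forall c, Wk2_loc k (fun x => F x ord0 c).

Definition Linfty_loc F :=
  forall K : set 'rV[R]_m, compact K ->
    exists C : R, \forall x \ae mu, K x -> `|F x| <= C.

End sobolev.

Section maps.
Variables (R : realType) (m q : nat) (N : set 'rV[R]_q).
Variable phi : 'rV[R]_m -> 'rV[R]_q.
Notation mu := (@lebesgue_rV R m).

Definition W22_loc_map :=
  Wk2_loc_vec 2 phi /\ \forall x \ae mu, N (phi x).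

(* d\phi(e_i) *)
Definition dphi (i : 'I_m) : 'rV[R]_m -> 'rV[R]_q := wD i phi.

(* The induced connection on \phi^* TN, \bar\nabla_{e_i} V. *)
Definition bnabla (i : 'I_m) (V : 'rV[R]_m -> 'rV[R]_q) :
    'rV[R]_m -> 'rV[R]_q :=
  fun x => wD i V x *m tproj N (phi x).

(* (\bar\nabla_{e_i} d\phi)(e_j); the domain is flat. *)
Definition hess (i j : 'I_m) : 'rV[R]_m -> 'rV[R]_q := bnabla i (dphi j).

Definition tension : 'rV[R]_m -> 'rV[R]_q := fun x => \sum_i hess i i x.

Definition blap (V : 'rV[R]_m -> 'rV[R]_q) : 'rV[R]_m -> 'rV[R]_q :=
  fun x => \sum_i bnabla i (bnabla i V) x.

Definition normsq_dphi x : R := \sum_i dotv (dphi i x) (dphi i x).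

Definition normsq_hess x : R := \sum_i \sum_j dotv (hess i j x) (hess i j x).

(* Sections of \phi^* TN used as test objects. When N is closed in R^q, every
   \psi smooth with compact support in R^q gives such a section x |-> the
   projection of \psi(x) to T_{\phi(x)} N, and the last condition follows from
   the others. *)
Definition test_section (V : 'rV[R]_m -> 'rV[R]_q) :=
  [/\ (\forall x \ae mu, tangent N (phi x) (V x)),
      (exists2 K : set 'rV[R]_m, compact K & forall x, ~ K x -> V x = 0),
      Linfty_loc V,
      Wk2_loc_vec 2 V &
      forall i, Wk2_loc_vec 1 (bnabla i V)].

Definition curv_term : 'rV[R]_m -> 'rV[R]_q :=
  fun x => \sum_j curvature N (phi x) (dphi j x) (tension x) (dphi j x).

(* \delta_2 \bar\Delta \tau = \delta_2 R(d\phi(e_j), \tau) d\phi(e_j)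
   + \delta_1 \tau, where \bar\Delta is moved to the test section. *)
Definition weak_solution (delta1 delta2 : R) :=
  (forall c, loc_integrable (fun x => curv_term x ord0 c)) /\
  forall V, test_section V ->
    delta2 * \int[mu]_x dotv (tension x) (blap V x) =
    delta2 * \int[mu]_x dotv (curv_term x) (V x)
    + delta1 * \int[mu]_x dotv (tension x) (V x).

Definition sym_tensor (k : 'I_m -> 'I_m -> 'rV[R]_m -> R) :=
  (forall i j, test_function (k i j)) /\ (forall i j, k i j = k j i).

Definition trace_tensor (k : 'I_m -> 'I_m -> 'rV[R]_m -> R) : 'rV[R]_m -> R :=
  fun x => \sum_i k i i x.

(* \int k^{ij} <d\phi(e_i), \bar\nabla_{e_j} \tau>, integrated by parts. *)
Definition pair_dphi_nabla_tau (k : 'I_m -> 'I_m -> 'rV[R]_m -> R) : R :=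
  - (\int[mu]_x \sum_i \sum_j
       pder j (k i j : 'rV[R]_m -> R^o) x * dotv (dphi i x) (tension x))
  - (\int[mu]_x \sum_i \sum_j k i j x * dotv (hess j i x) (tension x)).

(* \int k^{ij} g_{ij} \nabla_{e_l} <d\phi(e_l), \tau>, integrated by parts. *)
Definition pair_div_dphi_tau (k : 'I_m -> 'I_m -> 'rV[R]_m -> R) : R :=
  - (\int[mu]_x \sum_l
       pder l (trace_tensor k : 'rV[R]_m -> R^o) x
       * dotv (dphi l x) (tension x)).

(* \int k^{ij} S_{ij} *)
Definition stress_pairing (delta1 delta2 : R)
    (k : 'I_m -> 'I_m -> 'rV[R]_m -> R) : R :=
  delta1 * (\int[mu]_x \sum_i \sum_j k i j x *
      (2 * dotv (dphi i x) (dphi j x) - (i == j)%:R * normsq_dphi x))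
  + delta2 * (- (\int[mu]_x (trace_tensor k x * dotv (tension x) (tension x)))
              + 2 * pair_div_dphi_tau k)
  - 2 * delta2 * (pair_dphi_nabla_tau k
                  + pair_dphi_nabla_tau (fun i j => k j i)).

Definition stationary_solution (delta1 delta2 : R) :=
  weak_solution delta1 delta2 /\
  forall k, sym_tensor k -> stress_pairing delta1 delta2 k = 0.

Definition finite_energy :=
  (\int[mu]_x (normsq_dphi x + normsq_hess x)%:E < +oo)%E.

Definition harmonic_map := \forall x \ae mu, tension x = 0.

Definition trivial_map := exists c : 'rV[R]_q, \forall x \ae mu, phi x = c.

End maps.

(* Main.v *)
From HB Require Import structures.
Require Import Defs.
From mathcomp Require Import all_boot all_order all_algebra.
From mathcomp Require Import all_classical all_reals all_analysis.
From mathcomp Require Import measurable_realfun.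
From mathcomp Require Import ring lra.

Set Implicit Arguments.
Unset Strict Implicit.
Unset Printing Implicit Defensive.

Import Order.TTheory GRing.Theory Num.Theory.
Import numFieldNormedType.Exports.

Local Open Scope classical_set_scope.
Local Open Scope ring_scope.

(* Testing the stress-energy tensor against eta times the Euclidean metric gives
     delta1 (2 - m) INT eta |dphi|^2 + delta2 (4 - m) INT eta |tau|^2
       + (4 - 2 m) delta2 INT <dphi(grad eta), tau> = 0.
   For eta(x) = rho(x / k) and k -> oo the last term vanishes by dominated
   convergence, because dphi and tau are square integrable, so that
     delta1 (2 - m) INT |dphi|^2 + delta2 (4 - m) INT |tau|^2 = 0,
   and the signs force dphi = 0 or tau = 0. Two points need care: tau has to be
   measurable, which follows from the continuity of p |-> tproj N p on the
   locally closed set N; and dphi = 0 has to imply that phi is constant, which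
   is obtained by testing with products of functions of one variable, among
   which those with a factor of zero mean are derivatives of test functions. *)

(** * Smooth functions of one variable *)

(** Taking [k] conformal to the metric leaves, after the integrations by parts built into the
    pairing, a single term in which a derivative falls on eta. Rescaling gives it a factor tending
    to 0, while |<dphi(e_i), tau>| <= |dphi|^2 + |tau|^2 is a fixed integrable bound. All test
    functions used are products of one-variable functions built from exp (-1/s) with s a polynomial.
    A partial derivative then acts on a single factor, and limits of such products are the
    indicators of open boxes, a pi-system generating the measurable sets. This takes the place of
    mollification: a function annihilated by all derivatives of products has the same mean over
    every box. On the geometric side the obstacle is that [tproj] is selected by [get], so its
    definition says nothing about how it varies with the point. In a slice chart it is a Gram matrix
    expression in a Jacobian, hence continuous along [N]; off [N] it is a constant default. It is
    therefore measurable on the whole space and can be composed with [phi], which lies in [N] only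
    almost everywhere. *)

Section smooth_line.
Variable R : realType.
Implicit Types (g h : R -> R) (s Q : {poly R}).

Definition smooth1 g := forall n x, derivable (derive1n n g) x (1 : R).

Definition test1 g := smooth1 g /\ exists M : R, forall x, M < `|x| -> g x = 0.

Lemma derive1_is_derive g h : (forall x : R, is_derive x (1 : R) g (h x)) ->
  derive1 g = h.
Proof. by move=> dg; apply/funext => x; rewrite derive1E derive_val. Qed.

(** Coinduction principle: a class of functions stable under differentiation consists of smooth
    functions. Smoothness of an explicit family then needs one derivative rule and no formula for
    the iterates. *)
Lemma smooth1_coind (S : set (R -> R)) :
  (forall g, S g ->
    exists2 h, S h & forall x : R, is_derive x (1 : R) g (h x)) ->
  S `<=` smooth1.
Proof.
move=> Sd g Sg n x.
have Sgn : S (derive1n n g).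
  elim: n => [|n IH]; first by rewrite derive1n0.
  by have [h Sh /derive1_is_derive] := Sd _ IH; rewrite derive1nS => ->.
by have [h _ /(_ x)[]] := Sd _ Sgn.
Qed.

Lemma smooth1_derive g : smooth1 g -> smooth1 (derive1 g).
Proof. by move=> sg n x; rewrite -derive1Sn; exact: sg. Qed.

Lemma smooth1_is_derive g x : smooth1 g -> is_derive x (1 : R) g (derive1 g x).
Proof. by move=> /(_ 0 x) sg; rewrite derive1E; exact/derivableP. Qed.

Lemma smooth1_continuous g : smooth1 g -> continuous g.
Proof.
by move=> /(_ 0) sg x; apply/differentiable_continuous/derivable1_diffP/sg.
Qed.

Lemma smooth1_primitive g h :
  (forall x : R, is_derive x (1 : R) g (h x)) -> smooth1 h -> smooth1 g.
Proof.
move=> dg sh [|n] x; first by rewrite derive1n0; case: (dg x).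
by rewrite derive1Sn (derive1_is_derive dg); exact: sh.
Qed.

Lemma smooth1_lin a g h : smooth1 g -> smooth1 h ->
  smooth1 (fun x => a * g x + h x).
Proof.
move=> sg sh.
apply: (@smooth1_coind [set f | exists g h, [/\ smooth1 g, smooth1 h &
    f = fun x => a * g x + h x]]); last by exists g, h.
move=> _ [{sg}g [{sh}h [sg sh ->]]].
exists (fun x => a * (derive1 g) x + (derive1 h) x).
  by exists (derive1 g), (derive1 h); split=> //; exact: smooth1_derive.
move=> x; have := smooth1_is_derive x sg; have := smooth1_is_derive x sh.
move=> dh dg.
have -> : (fun x => a * g x + h x) = (a \*: g + h :> (R -> R)) by [].
exact: is_derive_eq.
Qed.

Lemma test1_lin a g h : test1 g -> test1 h -> test1 (fun x => a * g x + h x).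
Proof.
move=> [sg [M gM]] [sh [L hL]]; split; first exact: smooth1_lin.
by exists (Num.max M L) => x; rewrite gt_max => /andP[Mx Lx];
  rewrite gM// hL// mulr0 addr0.
Qed.

Lemma test1_derive g : test1 g -> test1 (derive1 g).
Proof.
move=> [sg [M gM]]; split; first exact: smooth1_derive.
exists M => x Mx; have nM : \forall y \near x, M < `|y|.
  by apply: (@cvgr_gt _ _ _ _ (fun y : R => `|y|) _ (@norm_continuous _ _ x)).
rewrite derive1E (@near_eq_derive _ _ _ _ (cst 0)) ?derive_cst//.
by near=> y; rewrite /= gM//; near: y; exact: nM.
Unshelve. all: by end_near. Qed.

Lemma test1_bounded g : test1 g -> exists C : R, forall x, `|g x| <= C.
Proof.
move=> [sg [M gM]].
have cg : {within `[- `|M|, `|M|], continuous (fun x => `|g x|)}.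
  apply: continuous_subspaceT => x; apply: cvg_norm.
  exact: smooth1_continuous.
have [c _ gc] := EVT_max (ge0_cp (normr_ge0 M)).2 cg.
exists `|g c| => x; have [xM|Mx] := leP `|x| `|M|.
  by apply: gc; rewrite in_itv/= -ler_norml.
by rewrite gM ?normr0// (le_lt_trans (ler_norm _) Mx).
Qed.

Lemma smooth1_measurable g :
  smooth1 g -> measurable_fun [set: measurableTypeR R] g.
Proof. by move=> /smooth1_continuous cg; exact: continuous_measurable_fun. Qed.

Lemma test1_integrable g :
  test1 g -> (@lebesgue_measure R).-integrable setT (EFin \o g).
Proof.
move=> [sg [M gM]].
have -> : EFin \o g = (EFin \o g) \_ `[- `|M|, `|M|].
  apply/funext => x; rewrite patchE; case: ifPn => //.
  rewrite notin_setE/= in_itv/= -ler_norml => /negP; rewrite -ltNge => Mx.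
  by rewrite gM// (le_lt_trans (ler_norm _) Mx).
have ig : (@lebesgue_measure R).-integrable `[- `|M|, `|M|] (EFin \o g).
  apply: (@continuous_compact_integrable R g `[- `|M|, `|M|]).
    exact: segment_compact.
  exact/continuous_subspaceT/smooth1_continuous.
by apply/(integrable_mkcond _ _).1.
Qed.

(** The primitive from -oo vanishes to the left of the support of [g]; to the right of it, it equals
    the full integral of [g], which is zero. Hence it has bounded support again. *)
Lemma test1_primitive g : test1 g ->
  \int[@lebesgue_measure R]_x g x = 0 ->
  exists2 h, test1 h & forall x : R, is_derive x (1 : R) h (g x).
Proof.
move=> tg g0; have ig := test1_integrable tg.
have [sg [M gM]] := tg.
pose G x := \int[@lebesgue_measure R]_(t in `]-oo, x]) g t.
have dG x : is_derive x (1 : R) G (g x).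
  have [] := @continuous_FTC1 R g -oo%O x (x + 1) _ _ _ _.
  - by rewrite ltrDl.
  - exact: integrableS ig.
  - by rewrite ltNyr.
  - exact: smooth1_continuous.
  by move=> ? <-; rewrite derive1E; exact/derivableP.
exists G => //; split; first exact: smooth1_primitive dG sg.
exists M => x Mx; have [x0|x0] := leP 0 x; last first.
  rewrite /G (@eq_Rintegral _ _ _ _ _ (cst 0)) ?Rintegral_cst ?mul0r// => t.
  rewrite inE/= in_itv/= => tx; apply: gM; rewrite (lt_le_trans Mx)//.
  by rewrite !ltr0_norm ?lerN2// (le_lt_trans tx).
rewrite /G Rintegral_mkcond -[RHS]g0; apply: eq_Rintegral => t _.
rewrite patchE; case: ifPn => //; rewrite notin_setE/= in_itv/= => /negP.
rewrite -ltNge => xt; rewrite gM// (lt_le_trans Mx)//.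
by rewrite !ger0_norm ?(ltW xt)// (le_trans x0 (ltW xt)).
Qed.

(** The bound forces [g t = 0] and makes the difference quotients O(|h|). It serves at the points
    where a flat function leaves its zero set. *)
Lemma is_derive_quadratic g t C :
  (\forall y \near t, `|g y| <= C * `|y - t| ^+ 2) -> is_derive t (1 : R) g 0.
Proof.
move=> gC; have gt0 : g t = 0.
  by have := nbhs_singleton gC; rewrite subrr normr0 expr0n/= mulr0 normr_le0
    => /eqP.
have C0 : 0 <= `|C| + 1 by rewrite addr_ge0.
have K : (h *: 1 + t) @[h --> (0 : R)^'] --> t.
  rewrite -[X in _ --> X]add0r -[X in _ --> X + _](scale0r (1 : R)).
  apply: cvgD; last exact: cvg_cst.
  by apply: cvgZr_tmp; exact: nbhs_dnbhs.
have gC' := K _ gC.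
have L : h^-1 *: (g (h *: 1 + t) - g t) @[h --> (0 : R)^'] --> (0 : R).
  apply/cvgr0Pnorm_le => e e0; near=> h.
  have h0 : h != 0 by near: h; exact: nbhs_dnbhs_neq.
  rewrite gt0 subr0 normrZ normfV ler_pdivrMl ?normr_gt0//.
  have gh : `|g (h *: 1 + t)| <= C * `|h| ^+ 2.
    have : `|g (h *: 1 + t)| <= C * `|h *: 1 + t - t| ^+ 2.
      by near: h; exact: gC'.
    by rewrite addrK [_ *: 1]mulr1.
  rewrite (le_trans gh)// expr2 mulrCA ler_wpM2l//.
  rewrite (le_trans (ler_wpM2r _ (ler_norm C)))//.
  rewrite (@le_trans _ _ ((`|C| + 1) * `|h|)) ?ler_wpM2r ?lerDl//.
  rewrite mulrC -ler_pdivlMr ?ltr_pwDr//.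
  near: h; apply: dnbhs0_le; rewrite divr_gt0// ltr_pwDr//.
by split; [apply/cvg_ex; exists 0|apply/cvg_lim].
Unshelve. all: by end_near. Qed.

Lemma poly_bounded_near (p : {poly R}) (t : R) :
  exists C : R, \forall y \near t, `|p.[y]| <= C.
Proof.
exists (`|p.[t]| + 1).
have H : `|p.[y]| @[y --> t] --> `|p.[t]|.
  by apply: cvg_norm; exact: continuous_horner.
by apply: (cvgr_le _ H); rewrite ltrDl.
Qed.

(* The flat functions [s > 0] Q s^-k exp (-1/s) are closed under derivation. *)
Definition flat s Q k : R -> R := fun t =>
  if 0 < s.[t] then Q.[t] * s.[t]^-1 ^+ k * expR (- s.[t]^-1) else 0.

(** The numerator over s^(k+2) of the derivative of Q s^-k exp (-1/s): the three terms come from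
    differentiating Q, s^-k and the exponential. *)
Definition flat_num s Q k : {poly R} :=
  Q^`() * s ^+ 2 - k%:R *: (s^`() * Q * s) + s^`() * Q.

(** The term of degree k+2 of the exponential series at 1/u absorbs u^-k and leaves the two powers
    of u required by [is_derive_quadratic]. *)
Lemma expRN_inv_le (u : R) k : 0 < u ->
  u^-1 ^+ k * expR (- u^-1) <= k.+2`!%:R * u ^+ 2.
Proof.
move=> u0; have := @expR_ge1Dxn _ u^-1 k.+1; rewrite invr_ge0 (ltW u0).
move=> /(_ isT) H; rewrite expRN.
rewrite ler_pdivrMr ?expR_gt0//.
have f0 : k.+2`!%:R != 0 :> R by rewrite pnatr_eq0 -lt0n fact_gt0.
have {1}-> : u^-1 ^+ k = k.+2`!%:R * u ^+ 2 * (u^-1 ^+ k.+2 / k.+2`!%:R).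
  rewrite [u^-1 ^+ k.+2]exprS [u^-1 ^+ k.+1]exprS.
  move: (u^-1 ^+ k) (k.+2`!%:R) f0 => w f f0.
  by field; rewrite f0 gt_eqF.
apply: ler_wpM2l; first by rewrite mulr_ge0// sqr_ge0.
by rewrite (le_trans _ H)// lerDr.
Qed.

Lemma is_derive_flat s Q k t :
  is_derive t (1 : R) (flat s Q k) (flat s (flat_num s Q k) k.+2 t).
Proof.
have [st|st] := ltP 0 s.[t]; last first.
  rewrite {2}/flat ifN -?leNgt//.
  (* Since [s - s.[t]] is divisible by X - t and [s.[t] <= 0], wherever [s.[y]] is positive it is
     O(|y - t|). This treats a zero of [s] and a negative value of [s] alike. *)
  have [q qE] : exists q : {poly R}, s - s.[t]%:P = q * ('X - t%:P).
    by apply/factor_theorem; rewrite /root !hornerE subrr.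
  have [C QC] := poly_bounded_near Q t; have [D qD] := poly_bounded_near q t.
  apply: (@is_derive_quadratic _ _ (`|C| * (k.+2`!%:R * `|D| ^+ 2))).
  near=> y; rewrite /flat; case: ifPn => [sy|_]; last first.
    by rewrite normr0 !mulr_ge0// exprn_ge0.
  have sD : s.[y] <= `|D| * `|y - t|.
    have : s.[y] - s.[t] = q.[y] * (y - t).
      by have := congr1 (fun p => p.[y]) qE; rewrite !hornerE.
    move=> E; rewrite (@le_trans _ _ `|s.[y] - s.[t]|)//.
      by rewrite (le_trans _ (ler_norm _))// lerDl oppr_ge0.
    rewrite E normrM ler_wpM2r// (le_trans _ (ler_norm D))//.
    by near: y.
  rewrite -!mulrA normrM; apply: ler_pM => //.
    by rewrite (le_trans _ (ler_norm C))//; near: y.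
  rewrite ger0_norm; last by rewrite mulr_ge0//
    ?expR_ge0 ?exprn_ge0 ?invr_ge0// ltW.
  rewrite (le_trans (expRN_inv_le k sy))// ler_wpM2l// mulrA -expr2 -exprMn.
  by rewrite lerXn2r ?nnegrE ?(ltW sy)// mulr_ge0.
have s0 : s.[t] != 0 by rewrite gt_eqF.
pose F y := Q.[y] * s.[y]^-1 ^+ k * expR (- s.[y]^-1).
have ns : \forall y \near t, F y = flat s Q k y.
  have /(cvgr_gt s.[t]) H := @continuous_horner R s t.
  near=> y; rewrite /flat ifT//; near: y; exact: H.
apply: (near_eq_is_derive ns).
rewrite /flat st /F.
have ds := is_deriveV s0 (is_derive_poly s t).
have dE := @is_derive1_comp R expR (- (fun y : R => s.[y]^-1)) t _ _
  (is_derive_expR _) (is_deriveN ds).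
have dX := is_deriveX k ds.
have := is_deriveM (is_deriveM (is_derive_poly Q t) dX) dE.
have -> : horner Q * (fun y => s.[y]^-1) ^+ k * (expR \o - (fun y => s.[y]^-1))
    = F.
  by apply/funext => y; rewrite /F !fctE.
move=> /is_derive_eq; apply.
rewrite /flat_num !(hornerD, hornerN, hornerM, hornerZ, horner_exp) 2!(exprS
  s.[t]^-1) !fctE.
case: k {F ns dE dX} => [|k].
  by rewrite !expr0 /GRing.scale/=; field.
rewrite succnK !(exprS s.[t]^-1); move: (s.[t]^-1 ^+ k) => w.
by rewrite /GRing.scale/=; field.
Unshelve. all: by end_near. Qed.

Lemma flat_smooth s Q k : smooth1 (flat s Q k).
Proof.
apply: (@smooth1_coind [set f | exists s Q k, f = flat s Q k]).
  move=> _ [{}s [{}Q [{}k ->]]]; exists (flat s (flat_num s Q k) k.+2).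
    by exists s, (flat_num s Q k), k.+2.
  exact: is_derive_flat.
by exists s, Q, k.
Qed.

End smooth_line.

(** * Product test functions *)

Section product_functions.
Variables (R : realType) (n : nat).
Implicit Types (g : 'I_n -> R -> R) (x : 'rV[R]_n).

Definition prodf g x : R := \prod_(i < n) g i (x ord0 i).

Definition upd g j (h : R -> R) : 'I_n -> R -> R :=
  fun i => if i == j then h else g i.

Lemma prodf_upd g j h x :
  prodf (upd g j h) x = h (x ord0 j) * \prod_(i < n | i != j) g i (x ord0 i).
Proof.
rewrite /prodf (bigD1 j)//= /upd eqxx; congr (_ * _).
by apply: eq_bigr => i /negPf ->.
Qed.

Lemma upd_id g j : upd g j (g j) = g.
Proof. by apply/funext => i; rewrite /upd; case: eqP => [->|]. Qed.

Lemma prodfD1 g j x :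
  prodf g x = g j (x ord0 j) * \prod_(i < n | i != j) g i (x ord0 i).
Proof. by rewrite -[in LHS](upd_id g j) prodf_upd. Qed.

Lemma is_derive_prodf g j x : smooth1 (g j) ->
  is_derive x (delta_mx ord0 j) (prodf g : 'rV[R]_n -> R^o)
    (prodf (upd g j (derive1 (g j))) x).
Proof.
move=> sg; rewrite prodf_upd.
set P := \prod_(i < n | i != j) _.
have dg : derivable (g j) (x ord0 j) (1 : R) by exact: (sg 0).
have L : h^-1 *: (prodf g (h *: delta_mx ord0 j + x) - prodf g x)
    @[h --> (0 : R)^'] --> (derive1 (g j) (x ord0 j) * P : R^o).
  have E h : h^-1 *: (prodf g (h *: delta_mx ord0 j + x) - prodf g x : R^o) =
      (h^-1 *: (g j (h *: 1 + x ord0 j) - g j (x ord0 j))) * P.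
    rewrite !(prodfD1 g j).
    have -> : (h *: delta_mx ord0 j + x) ord0 j = h *: 1 + x ord0 j.
      by rewrite !mxE !eqxx.
    have -> : \prod_(i < n | i != j) g i ((h *: delta_mx ord0 j + x) ord0 i) =
      P.
      by apply: eq_bigr => i ij; rewrite !mxE (negPf ij) andbF mulr0 add0r.
    by rewrite -mulrBl -scalerAl.
  have L : (h^-1 *: (g j (h *: 1 + x ord0 j) - g j (x ord0 j))) * P
      @[h --> (0 : R)^'] --> derive1 (g j) (x ord0 j) * P.
    by apply: cvgMr_tmp; rewrite derive1E; exact: dg.
  apply: (cvg_trans _ L).
  by apply: near_eq_cvg; apply: nearW => h; rewrite E.
by split; [apply/cvg_ex; eexists; exact: L|apply/cvg_lim].
Qed.

Lemma pder_prodf g j : smooth1 (g j) ->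
  pder j (prodf g : 'rV[R]_n -> R^o) = prodf (upd g j (derive1 (g j))).
Proof.
by move=> sg; apply/funext => x;
  rewrite /pder (@derive_val _ _ _ _ _ _ _ (is_derive_prodf x sg)).
Qed.

(** Derivatives in different directions act on different factors, so only the multiplicity of each
    index in [s] matters, and a product of smooth functions is smooth in the sense of
    [smooth_on]. *)
Lemma pders_prodf g s : (forall i, smooth1 (g i)) ->
  pders s (prodf g : 'rV[R]_n -> R^o) =
  prodf (fun i => derive1n (count_mem i s) (g i)).
Proof.
move=> sg; elim: s => [|j s IH] //=.
rewrite IH pder_prodf; last by move=> k; rewrite /derive1n -iterD; exact: sg.
congr prodf; apply/funext => i; rewrite /upd [j == i]eq_sym.
by case: eqP => [->|_]; rewrite ?add0n// add1n derive1nS.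
Qed.

Lemma continuous_prodf g : (forall i, continuous (g i)) ->
  continuous (prodf g : 'rV[R]_n -> R^o).
Proof.
move=> cg; apply: continuous_big => [|i _ x].
  exact: mul_continuous.
apply: (@continuous_comp _ _ _ (fun y : 'rV[R]_n => y ord0 i) (g i)).
  exact: coord_continuous.
exact: cg.
Qed.

Lemma measurable_prodf g : (forall i, smooth1 (g i)) ->
  measurable_fun [set: 'rV[R]_n] (prodf g).
Proof.
move=> sg; apply: measurable_prod => i _.
apply: (@measurableT_comp _ _ _ _ _ _ (g i) _ (rV_coord i)).
  exact: smooth1_measurable.
exact: measurable_rV_coord.
Qed.

Lemma bounded_prodf g : (forall i, test1 (g i)) ->
  exists C : R, forall x, `|prodf g x| <= C.
Proof.
move=> /(_ _)/test1_bounded/cid-/all_sig[C gC].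
exists (\prod_i C i) => x; rewrite normr_prod; apply: ler_prod => i _.
by rewrite normr_ge0 gC.
Qed.

Lemma compact_box (M : R) : compact [set x : 'rV[R]_n | forall i, `|x ord0 i|
  <= M].
Proof.
rewrite (_ : [set x | _] = [set x : 'rV[R]_n | forall i, `[- M, M]%classic (x
  ord0 i)]).
  apply: (@rV_compact R n (fun=> `[- M, M]%classic)) => i.
  exact: segment_compact.
by apply/seteqP; split => x H i; have := H i; rewrite /= in_itv/= ler_norml.
Qed.

Lemma prodf_support g : (forall i, test1 (g i)) ->
  exists M : R, forall x, prodf g x != 0 -> forall i, `|x ord0 i| <= M.
Proof.
move=> tg.
have /all_sig[M gM] i : {M : R | forall t, M < `|t| -> g i t = 0}.
  by apply/cid; case: (tg i).
exists (\big[Num.max/0]_i M i) => x /eqP gx i.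
rewrite leNgt; apply/negP => Mx; apply: gx.
by rewrite (prodfD1 _ i) gM ?mul0r// (le_lt_trans _ Mx)//; exact: le_bigmax.
Qed.

Lemma test_function_prodf g : (forall i, test1 (g i)) ->
  test_function (prodf g).
Proof.
move=> tg; have sg i : smooth1 (g i) by case: (tg i).
split.
  move=> s x _; rewrite pders_prodf//.
  have sgs i : smooth1 (derive1n (count_mem i s) (g i)).
    by move=> k; rewrite /derive1n -iterD; exact: sg.
  split; last by move=> i; have [] := @is_derive_prodf (fun i =>
    derive1n _ (g i)) i x (sgs i).
  exact/continuous_prodf/(fun i => smooth1_continuous (sgs i)).
have [M gM] := prodf_support tg.
apply: (subclosed_compact _ (@compact_box M)); first exact: closed_closure.
have cM : closed [set x : 'rV[R]_n | forall i, `|x ord0 i| <= M].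
  by apply: compact_closed; [exact: norm_hausdorff|exact: compact_box].
rewrite [X in _ `<=` X](closure_id _).1//; apply: closure_subset => x /=.
exact: gM.
Qed.

End product_functions.

(** * Dominated convergence and boxes *)

Section integration.
Context d (T : measurableType d) (R : realType) (mu : {measure set T -> \bar
  R}).
Implicit Types f u v : T -> R.

Lemma integrable_mul_bounded f u (C : R) :
  mu.-integrable setT (EFin \o f) -> measurable_fun setT u ->
  (forall x, `|u x| <= C) -> mu.-integrable setT (EFin \o (fun x => f x * u x)).
Proof.
move=> intf mu_ uC; have mf : measurable_fun setT f.
  by apply/measurable_EFinP; exact: measurable_int intf.
apply: (@le_integrable _ _ _ _ _ _ _ (fun x => C%:E * `|(EFin \o f) x|)%E) =>
  //.
- by apply/measurable_EFinP; exact: measurable_funM.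
- move=> x _ /=; have C0 : 0 <= C by rewrite (le_trans _ (uC x)).
  by rewrite lee_fin normrM mulrC [leRHS]ger0_norm ?mulr_ge0// ler_wpM2r.
- by apply: integrableZl => //; exact: integrable_abse.
Qed.

Lemma cvg_Rintegral_dominated (F : nat -> T -> R) f (G : T -> R) :
  (forall k, measurable_fun setT (F k)) -> measurable_fun setT f ->
  mu.-integrable setT (EFin \o G) -> (forall k x, `|F k x| <= G x) ->
  (forall x, F k x @[k --> \oo] --> f x) ->
  \int[mu]_x F k x @[k --> \oo] --> \int[mu]_x f x.
Proof.
move=> mF mf intG FG Ff.
have [|||||iv _ H] := @dominated_convergence _ T R mu setT measurableT
   (fun k x => (F k x)%:E) (fun x => (f x)%:E) (EFin \o G).
- by move=> k; exact/measurable_EFinP.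
- exact/measurable_EFinP.
- by apply: aeW => x _; apply: cvg_EFin; [exact: nearW|exact: Ff].
- exact: intG.
- by apply: aeW => x k _ /=; rewrite lee_fin.
apply: fine_cvg; rewrite fineK//.
exact: integrable_fin_num.
Qed.

Lemma cvg_Rintegral_mul f v (u : nat -> T -> R) (C : R) :
  mu.-integrable setT (EFin \o f) -> (forall k, measurable_fun setT (u k)) ->
  measurable_fun setT v -> (forall k x, `|u k x| <= C) ->
  (forall x, u k x @[k --> \oo] --> v x) ->
  \int[mu]_x (f x * u k x) @[k --> \oo] --> \int[mu]_x (f x * v x).
Proof.
move=> intf mu_ mv uC uv; have mf : measurable_fun setT f.
  by apply/measurable_EFinP; exact: measurable_int intf.
apply: (@cvg_Rintegral_dominated _ _ (fun x => C * `|f x|)).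
- by move=> k; exact: measurable_funM.
- exact: measurable_funM.
- rewrite (_ : EFin \o _ = (fun x => C%:E * `|(EFin \o f) x|)%E).
    by apply: integrableZl => //; exact: integrable_abse.
  by apply/funext => x; rewrite /= EFinM.
- by move=> k x; rewrite normrM mulrC ler_wpM2r.
- by move=> x; apply: cvgMl_tmp; exact: uv.
Qed.

End integration.

(** * Measures given by a density *)

Section density.
Context d (T : measurableType d) (R : realType) (mu : {measure set T -> \bar
  R}).
Variable f : T -> \bar R.
Hypotheses (mf : measurable_fun setT f) (f0 : forall x, (0 <= f x)%E).

(** The proofs are arguments so that the term [density mf f0] by itself determines its measure
    structure. *)
Definition density of measurable_fun setT f & forall x, (0 <= f x)%E :=
  fun A => (\int[mu]_(x in A) f x)%E.

Notation nu := (density mf f0).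

Let density0 : nu set0 = 0%E.
Proof. by rewrite /density integral_set0. Qed.

Let density_ge0 A : (0 <= nu A)%E.
Proof. exact: integral_ge0. Qed.

HB.instance Definition _ := isMeasure.Build _ _ _ nu density0 density_ge0
  (semi_sigma_additive_nng_induced mf f0).

End density.

(** * Open boxes as a generating pi-system *)

Section boxes.
Variables (R : realType) (n : nat).
Notation mu := (lebesgue_rV R n).

Definition box (a b : 'I_n -> R) : set 'rV[R]_n :=
  [set v | forall i, `]a i, b i[%classic (v ord0 i)].

Lemma measurable_box a b : measurable (box a b).
Proof. exact: (@measurable_rV_box R n (fun i => `]a i, b i[%classic)). Qed.

Lemma ler_coord_norm (v : 'rV[R]_n) i : `|v ord0 i| <= `|v|.
Proof. by rewrite [leRHS]mx_normrE; exact: (le_bigmax _ _ (ord0, i)). Qed.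

Definition cube (k : nat) := box (fun=> - k%:R) (fun=> k%:R).

Lemma cubeE k : cube k = [set v | forall i, `|v ord0 i| < k%:R].
Proof. by apply/seteqP; split => v H i; have := H i;
  rewrite /= in_itv/= ltr_norml. Qed.

Lemma norm_lt_nat (v : 'rV[R]_n) k :
  (Num.truncn `|v| < k)%N -> forall i, `|v ord0 i| < k%:R.
Proof.
move=> vk i; apply: (le_lt_trans (ler_coord_norm v i)).
by rewrite (lt_le_trans (truncnS_gt _))// ler_nat.
Qed.

Definition open_boxes : set (set 'rV[R]_n) := [set A | exists a b, A = box a b].

(** The coordinates generate the measurable sets, and each half-space x < v_i is a countable union
    of boxes. Thus the identity is measurable from the sigma-algebra of the boxes. *)
Lemma measurable_rV_open_boxes :
  @measurable _ 'rV[R]_n = <<s open_boxes >>.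
Proof.
apply/seteqP; split; last first.
  apply: smallest_sub; first exact: sigma_algebra_measurable.
  by move=> _ [a [b ->]]; exact: measurable_box.
move=> A mA.
have mid : measurable_fun [set: g_sigma_algebraType open_boxes]
    (id : g_sigma_algebraType open_boxes -> 'rV[R]_n).
  apply: measurable_rVP => i.
  apply: (measurability _ (RGenOInfty.measurableE R)) => _ [_ [x ->] <-].
  rewrite setTI [X in measurable X](_ : _ = \bigcup_k
      box (fun j => if j == i then x else - k%:R) (fun=> k%:R)).
    by apply: bigcup_measurable => k _; apply: sub_sigma_algebra; do 2 eexists.
  apply/seteqP; split => v /=.
    rewrite in_itv/= andbT => xv; exists (Num.truncn `|v|).+1 => // j.
    have := norm_lt_nat (ltnSn (Num.truncn `|v|)) j; rewrite ltr_norml =>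
      /andP[v1 v2].
    by rewrite /= in_itv/= v2 andbT; case: eqP => [->|].
  by move=> [k _ /(_ i)]; rewrite /= eqxx !in_itv/= andbT => /andP[].
by have := mid measurableT _ mA; rewrite setTI.
Qed.

Lemma open_boxesI : setI_closed open_boxes.
Proof.
move=> _ _ [a [b ->]] [a' [b' ->]].
exists (fun i => Num.max (a i) (a' i)), (fun i => Num.min (b i) (b' i)).
apply/seteqP; split => [v [va vb] i|v H].
  have := va i; have := vb i; rewrite /= !in_itv/= => /andP[? ?] /andP[? ?].
  by rewrite gt_max lt_min; apply/andP; split; apply/andP.
by split => i; have := H i;
  rewrite /= !in_itv/= gt_max lt_min => /andP[/andP[? ?] /andP[? ?]];
    apply/andP.
Qed.

Lemma cube_cover : \bigcup_k cube k = setT.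
Proof.
rewrite -subTset => v _; exists (Num.truncn `|v|).+1 => //.
by rewrite cubeE; exact: norm_lt_nat.
Qed.

Lemma mu_box a b : mu (box a b) = (\prod_i fine (lebesgue_measure `]a i, b
  i[))%:E.
Proof.
rewrite (@lebesgue_rV_box R n (fun i => `]a i, b i[%classic))//.
rewrite -prodEFin; apply: eq_bigr => i _; rewrite fineK//.
by rewrite lebesgue_measure_itv; case: ifP.
Qed.

Lemma box0 a b i : b i <= a i -> box a b = set0.
Proof.
move=> ba; rewrite -subset0 => v /(_ i); rewrite /= in_itv/= => /andP[av vb].
by have := lt_trans av vb; rewrite ltNge ba.
Qed.

Lemma box_sub_cube a b : exists k, box a b `<=` cube k.
Proof.
pose M := \sum_i (`|a i| + `|b i|).
exists (Num.truncn M).+1; rewrite cubeE => v vab i.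
apply: le_lt_trans (truncnS_gt M).
have : `|a i| + `|b i| <= M.
  by rewrite /M (bigD1 i)//= lerDl sumr_ge0// => j _; rewrite addr_ge0.
apply: le_trans.
have := vab i; rewrite /= in_itv/= => /andP[av vb].
have := ler_norm (- a i); have := ler_norm (b i); rewrite normrN => bi ai.
have := normr_ge0 (a i); have := normr_ge0 (b i) => b0 a0.
by rewrite ler_norml; apply/andP; split; lra.
Qed.

(* The positive and the negative part of f are densities of two measures that
   agree on the pi-system of boxes. *)
Lemma ae_eq0_boxes (f : 'rV[R]_n -> R) :
  measurable_fun setT f ->
  (forall k, mu.-integrable (cube k) (EFin \o f)) ->
  (forall a b, \int[mu]_(x in box a b) (f x)%:E = 0)%E ->
  \forall x \ae mu, f x = 0.
Proof.
move=> mf intf f0; pose F := EFin \o f.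
have mF : measurable_fun setT F by exact/measurable_EFinP.
have mP := measurable_funepos mF; have mN := measurable_funeneg mF.
pose m1 : {measure set 'rV[R]_n -> \bar R} := density mu mP (funepos_ge0 F).
pose m2 : {measure set 'rV[R]_n -> \bar R} := density mu mN (funeneg_ge0 F).
have intb a b : mu.-integrable (box a b) F.
  have [k bk] := box_sub_cube a b.
  by apply: integrableS (intf k);
    [exact: measurable_box|exact: measurable_box|].
have m12 A : measurable A -> m1 A = m2 A.
  apply: (measure_unique open_boxes cube).
  - exact: measurable_rV_open_boxes.
  - exact: open_boxesI.
  - by move=> k; do 2 eexists.
  - exact: cube_cover.
  - move=> _ [a [b ->]]; rewrite /m1 /m2 /= /density.
    have iP : (\int[mu]_(x in box a b) F^\+ x)%E \is a fin_num.
      apply: integrable_fin_num; first exact: measurable_box.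
      by apply: integrable_funepos => //; exact: measurable_box.
    have iN : (\int[mu]_(x in box a b) F^\- x)%E \is a fin_num.
      apply: integrable_fin_num; first exact: measurable_box.
      by apply: integrable_funeneg => //; exact: measurable_box.
    have : (\int[mu]_(x in box a b) F^\+ x - \int[mu]_(x in box a b) F^\- x =
      0)%E.
      by rewrite -integralE; exact: f0.
    rewrite -(fineK iP) -(fineK iN) -EFinB => -[].
    by move=> /eqP; rewrite subr_eq0 => /eqP ->.
  - move=> k; rewrite /m1 /= /density.
    by apply: integral_funepos_lt_pinfty => //; exact: measurable_box.
have mS : measurable [set x | (0 < F x)%E].
  by rewrite -[X in measurable X]setTI; exact: emeasurable_fun_o_infty.
have mS' : measurable [set x | (F x < 0)%E].
  by rewrite -[X in measurable X]setTI; exact: emeasurable_fun_infty_o.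
(* On the set where [F] is positive its negative part vanishes, so [m2], and with it [m1], gives
   this set measure zero; hence the positive part is zero almost everywhere there. [N0] is the
   mirror image. *)
have P0 : ae_eq mu [set x | (0 < F x)%E] (F^\+)%E (cst 0%E).
  apply/ae_eq_integral_abs => //; first exact: measurable_funTS.
  under eq_integral do rewrite gee0_abs ?funepos_ge0//.
  rewrite -[LHS]/(m1 _) m12// /m2/= /density.
  apply: integral0_eq => x Fx; rewrite funenegE.
  by apply/max_idPr; rewrite leeNl oppe0 ltW.
have N0 : ae_eq mu [set x | (F x < 0)%E] (F^\-)%E (cst 0%E).
  apply/ae_eq_integral_abs => //; first exact: measurable_funTS.
  under eq_integral do rewrite gee0_abs ?funeneg_ge0//.
  rewrite -[LHS]/(m2 _) -m12// /m1/= /density.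
  by apply: integral0_eq => x Fx; rewrite funeposE; apply/max_idPr; rewrite ltW.
move: P0 N0; apply: filterS2 => x Px Nx.
have [fx|fx|//] := ltgtP (f x) 0.
- have : (F^\- x = 0)%E by apply: Nx; rewrite /= lte_fin.
  rewrite funenegE max_l; first by move=> [/eqP]; rewrite oppr_eq0 => /eqP.
  by rewrite -EFinN lee_fin oppr_ge0 ltW.
- have : (F^\+ x = 0)%E by apply: Px; rewrite /= lte_fin.
  by rewrite funeposE max_l; [move=> []|rewrite lee_fin ltW].
Qed.

End boxes.

(** * Functions with zero weak gradient *)

Section plateau.
Variable R : realType.
Implicit Types (a b t : R) (k : nat).

(** For a < b this is exp (-1 / (k (t - a) (b - t))) inside the interval and 0 outside. As k grows
    it tends to 1 at every interior point, so the indicator of the open interval is a bounded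
    pointwise limit of smooth functions supported in its closure. *)
Definition plateau a b k : R -> R :=
  flat (k%:R *: (('X - a%:P) * (b%:P - 'X))) 1 0.

Lemma plateauE a b k t : plateau a b k t =
  if 0 < k%:R * ((t - a) * (b - t)) then expR (- (k%:R * ((t - a) * (b -
    t)))^-1)
  else 0.
Proof.
have E : (k%:R *: (('X - a%:P) * (b%:P - 'X))).[t] = k%:R * ((t - a) * (b - t)).
  by rewrite hornerZ hornerM !hornerD !hornerN hornerX !hornerC.
by rewrite /plateau /flat E hornerC expr0 !mul1r.
Qed.

Lemma plateau_out a b k t : a < b -> ~ `]a, b[%classic t -> plateau a b k t = 0.
Proof.
move=> ab; rewrite plateauE /= in_itv/= => tab; rewrite ifF//; apply/negbTE.
rewrite -leNgt mulr_ge0_le0//.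
have [at_|ta] := leP t a; first by rewrite mulr_le0_ge0//; lra.
have [tb|bt] := ltP t b; first by exfalso; apply: tab; rewrite ta.
by rewrite mulr_ge0_le0//; lra.
Qed.

Lemma plateau_bounded a b k t : `|plateau a b k t| <= 1.
Proof.
rewrite plateauE; case: ifPn => st; last by rewrite normr0.
by rewrite ger0_norm ?expR_ge0// expR_le1 oppr_le0 invr_ge0 ltW.
Qed.

Lemma plateau_cvg a b t : a < b ->
  plateau a b k t @[k --> \oo] --> (\1_(`]a, b[%classic) t : R).
Proof.
move=> ab; rewrite indicE; have [/set_mem|/negP tab] := boolP (t \in _);
  last first.
  rewrite (_ : (fun k => _) = cst 0); first exact: cvg_cst.
  by apply/funext => k; rewrite plateau_out// => tab'; apply: tab;
    exact/mem_set.
rewrite /= in_itv/= => /andP[at_ tb].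
pose c := (t - a) * (b - t); have c0 : 0 < c by rewrite mulr_gt0 ?subr_gt0.
have L : expR (- (c^-1 * (k.+1%:R)^-1)) @[k --> \oo] --> (1 : R).
  rewrite -[X in _ --> X]expR0; apply: continuous_cvg;
    first exact: continuous_expR.
  rewrite -[X in _ --> X]oppr0; apply: cvgN.
  rewrite -[X in _ --> X](mulr0 c^-1); apply: cvgMl_tmp.
  exact: cvg_harmonic.
rewrite -(cvg_shiftS (fun k => plateau a b k t)).
rewrite (_ : (fun k => _) = fun k => expR (- (c^-1 * (k.+1%:R)^-1)))//.
by apply/funext => k; rewrite plateauE -/c mulr_gt0// invfM mulrC.
Qed.

Lemma plateau_smooth a b k : smooth1 (plateau a b k).
Proof. exact: flat_smooth. Qed.

Lemma plateau_test a b k : a < b -> test1 (plateau a b k).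
Proof.
move=> ab; split; first exact: plateau_smooth.
exists (`|a| + `|b|) => t Mt; apply: plateau_out => //=.
rewrite in_itv/= => /andP[at_ tb]; move: Mt; apply/negP;
  rewrite -leNgt ler_norml.
have := ler_norm (- a); have := ler_norm b; rewrite normrN.
by have := normr_ge0 a; have := normr_ge0 b => *; apply/andP; split; lra.
Qed.

Lemma plateau_int_cvg a b : a < b ->
  \int[@lebesgue_measure R]_t plateau a b k t @[k --> \oo] -->
    fine (@lebesgue_measure R `]a, b[).
Proof.
move=> ab; pose I : R -> R := \1_(`]a, b[%classic).
have II t : I t * I t = I t.
  by rewrite /I indicE; case: (_ \in _); rewrite ?mulr1 ?mulr0.
have iI : (@lebesgue_measure R).-integrable setT (EFin \o I).
  exact: (@integrable_indic_itv R a b false true).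
(* The indicator plays two roles: as an integrable factor it supplies the dominating function, and
   it is the pointwise limit. Multiplying by it changes neither the plateaus nor itself. *)
have := @cvg_Rintegral_mul _ _ R lebesgue_measure I I (plateau a b) 1 iI _ _
  (plateau_bounded a b) (fun t => @plateau_cvg a b t ab).
have -> : \int[@lebesgue_measure R]_x (I x * I x) = fine (@lebesgue_measure R
  `]a, b[).
  under eq_Rintegral do rewrite II.
  by rewrite /Rintegral integral_indic// setIT.
have -> : (fun k => \int[@lebesgue_measure R]_x (I x * plateau a b k x)) =
          (fun k => \int[@lebesgue_measure R]_x plateau a b k x).
  apply/funext => k; apply: eq_Rintegral => t _; rewrite /I indicE.
  have [_|/negP tab] := boolP (t \in _); first by rewrite mul1r.
  by rewrite plateau_out ?mulr0// => tab'; apply: tab; exact/mem_set.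
apply.
- by move=> k; apply: smooth1_measurable; exact: plateau_smooth.
- exact: measurable_indic.
Qed.

(** The integrals of the plateaus on the unit interval tend to 1, so one of them is positive and can
    be normalised. *)
Lemma test1_unit_mass : exists2 r : R -> R, test1 r &
  \int[@lebesgue_measure R]_t r t = 1.
Proof.
have := @plateau_int_cvg 0 1 ltr01.
rewrite lebesgue_measure_itv/= lte_fin ltr01 oppr0 adde0/= => /(cvgr_gt 1).
move=> /(_ 0 ltr01)[k _ /(_ k (leqnn k))/= hk].
set h := plateau 0 1 k in hk; set I := \int[_]_t _ in hk.
have th : test1 h by exact: plateau_test.
have z : test1 (fun=> 0 : R).
  split; last by exists 0.
  apply: (@smooth1_coind _ [set (fun=> 0)]) => // _ ->; exists (fun=> 0) => //
    x.
  exact: is_derive_cst.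
exists (fun t => I^-1 * h t + 0); first exact: test1_lin.
under eq_Rintegral do rewrite addr0.
by rewrite RintegralZl ?mulVf ?gt_eqF//; exact: test1_integrable.
Qed.

End plateau.

(** * Constancy from testing with product functions *)

Section zero_weak_gradient.
Variables (R : realType) (n : nat).
Notation mu := (lebesgue_rV R n).
Notation leb := (@lebesgue_measure R).
Implicit Types (f : 'rV[R]_n -> R) (g : 'I_n -> R -> R).

Lemma loc_integrable_integrable f (K : set 'rV[R]_n) : loc_integrable f ->
  compact K ->
  measurable K -> mu.-integrable K (EFin \o f).
Proof.
move=> [mf fK] cK mK; apply/integrableP; split.
  by apply/measurable_EFinP; exact: measurable_funTS.
exact: fK.
Qed.

Definition ccube (M : R) : set 'rV[R]_n := [set x | forall i, `|x ord0 i| <= M].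

Lemma measurable_ccube M : measurable (ccube M).
Proof.
rewrite (_ : ccube M = [set x | forall i, `[- M, M]%classic (x ord0 i)]).
  exact: (@measurable_rV_box R n (fun=> `[- M, M]%classic)).
by apply/seteqP; split => x H i; have := H i; rewrite /= in_itv/= ler_norml.
Qed.

Lemma integrable_patch f M : loc_integrable f ->
  mu.-integrable setT (EFin \o (f \_ (ccube M))).
Proof.
move=> lf; rewrite -restrict_EFin.
apply/(integrable_mkcond _ (measurable_ccube M)).
by apply: loc_integrable_integrable => //;
  [exact: compact_box|exact: measurable_ccube].
Qed.

Lemma loc_integrable_box f a b :
  loc_integrable f -> mu.-integrable (box a b) (EFin \o f).
Proof.
move=> lf; have [k bk] := box_sub_cube a b.
have bk' : box a b `<=` ccube k%:R.
  by move=> x /bk; rewrite cubeE => xk i; exact/ltW/xk.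
apply: integrableS bk' _; [exact: measurable_ccube|exact: measurable_box|].
by apply: loc_integrable_integrable => //;
  [exact: compact_box|exact: measurable_ccube].
Qed.

Lemma indic_box a b (x : 'rV[R]_n) :
  \1_(box a b) x = \prod_i (\1_(`]a i, b i[%classic) (x ord0 i)) :> R.
Proof.
rewrite [LHS]indicE; have [/set_mem xab|/negP xab] := boolP (x \in _).
  by rewrite big1// => i _; rewrite indicE mem_set//; exact: xab.
have /existsNP[i xi] : ~ box a b x by move=> xab'; apply/xab/mem_set.
by rewrite (bigD1 i)//= indicE memNset ?mul0r.
Qed.

Lemma integrable_mul_prodf f g : loc_integrable f -> (forall i, test1 (g i)) ->
  mu.-integrable setT (EFin \o (fun x => f x * prodf g x)).
Proof.
move=> lf tg; have [M gM] := prodf_support tg; have [C gC] := bounded_prodf tg.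
rewrite (_ : (fun x => _) = fun x => (f \_ (ccube M)) x * prodf g x).
  apply: integrable_mul_bounded gC; first exact: integrable_patch.
  by apply: measurable_prodf => i; case: (tg i).
apply/funext => x; rewrite patchE; have [->|gx] := eqVneq (prodf g x) 0.
  by rewrite !mulr0.
by rewrite mem_set//; exact: gM.
Qed.

Section proof.
Variable f : 'rV[R]_n -> R.
Hypothesis lf : loc_integrable f.
Hypothesis f_grad : forall i g, (forall j, test1 (g j)) ->
  \int[mu]_x (f x * pder i (prodf g : 'rV[R]_n -> R^o) x) = 0.

Let L g := \int[mu]_x (f x * prodf g x).

(* A test function with zero mean is a derivative, so only the mean of each
   factor is seen by L. *)
Let L_upd g i (r : R -> R) : (forall j, test1 (g j)) -> test1 r ->
  \int[leb]_t r t = 1 -> L g = (\int[leb]_t g i t) * L (upd g i r).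
Proof.
move=> tg tr r1; set c := \int[leb]_t g i t.
pose h t := (- c) * r t + g i t.
have th : test1 h by exact: test1_lin.
have h0 : \int[leb]_t h t = 0.
  rewrite RintegralD//; first last.
  - exact: test1_integrable.
  - have -> : EFin \o (fun t => - c * r t) = (fun t => (- c)%:E * (r t)%:E)%E.
      by apply/funext => t; rewrite /= EFinM.
    by apply: integrableZl => //; exact: test1_integrable.
  rewrite RintegralZl//; last exact: test1_integrable.
  by rewrite r1 mulr1 addNr.
have [H tH dH] := test1_primitive th h0.
have tu u : test1 u -> forall j, test1 (upd g i u j).
  by move=> tu j; rewrite /upd; case: ifP.
have := f_grad i (tu _ tH).
rewrite pder_prodf; last by rewrite /upd eqxx; case: tH.
have -> : upd (upd g i H) i (derive1 (upd g i H i)) = upd g i h.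
  apply/funext => j; rewrite /upd eqxx; case: eqP => // _.
  exact: derive1_is_derive.
have E x : f x * prodf (upd g i h) x = f x * prodf g x - c * (f x * prodf (upd
  g i r) x).
  by rewrite !prodf_upd (prodfD1 g i) /h; ring.
move=> I0.
have : \int[mu]_x (f x * prodf g x - c * (f x * prodf (upd g i r) x)) = 0.
  by rewrite -[RHS]I0; apply: eq_Rintegral => x _; rewrite E.
have ir := integrable_mul_prodf lf (tu _ tr).
rewrite RintegralB//; last 2 first.
- exact: integrable_mul_prodf.
- rewrite (_ : EFin \o _ = (fun x => c%:E * (f x * prodf (upd g i r) x)%:E)%E).
    exact: integrableZl.
  by apply/funext => x; rewrite /= EFinM.
by rewrite RintegralZl// => /eqP; rewrite subr_eq0 => /eqP.
Qed.

Let L_mean g (r : R -> R) : (forall j, test1 (g j)) -> test1 r ->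
  \int[leb]_t r t = 1 -> L g = (\prod_i \int[leb]_t g i t) * L (fun=> r).
Proof.
move=> tg tr r1.
(* The factors are replaced by [r] one index at a time. Uniqueness of the list guarantees that slot
   [i] still holds [g i] when its integral is split off. *)
have H s : uniq s -> L g = (\prod_(i <- s) \int[leb]_t g i t) *
    L (fun i => if i \in s then r else g i).
  elim: s => [_|i s IH /= /andP[si us]].
    by rewrite big_nil mul1r; congr L; apply/funext => i; rewrite in_nil.
  rewrite IH// big_cons (@L_upd _ i r)//; last by move=> j; case: ifP.
  rewrite (negPf si) mulrA [X in X * _]mulrC; congr (_ * L _).
  by apply/funext => j; rewrite /upd in_cons; case: eqP.
rewrite (H (index_enum _)) ?index_enum_uniq//; congr (_ * L _).
by apply/funext => j; rewrite mem_index_enum.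
Qed.

(** Two evaluations of the limit of [L (g k)] for products of plateaus: dominated convergence gives
    the integral of [f] over the box, and [L_mean] gives the volume of the box times a number
    independent of the box. *)
Let L_box (r : R -> R) a b : test1 r -> \int[leb]_t r t = 1 ->
  (forall i, a i < b i) ->
  \int[mu]_(x in box a b) f x = (\prod_i fine (leb `]a i, b i[)) * L (fun=> r).
Proof.
move=> tr r1 ab; pose g k i := plateau (a i) (b i) k.
have tg k i : test1 (g k i) by exact: plateau_test.
have out k x : ~ box a b x -> prodf (g k) x = 0.
  move=> /existsNP[i xi]; rewrite (prodfD1 _ i) /g plateau_out ?mul0r//.
have iB : mu.-integrable setT (EFin \o (f \_ (box a b))).
  rewrite -restrict_EFin; apply/(integrable_mkcond _ (measurable_box a b)).
  exact: loc_integrable_box.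
have cL : L (g k) @[k --> \oo] --> \int[mu]_(x in box a b) f x.
  have := @cvg_Rintegral_mul _ _ R mu (f \_ (box a b)) (\1_(box a b))
    (fun k => prodf (g k)) 1 iB.
  have -> : \int[mu]_x ((f \_ (box a b)) x * \1_(box a b) x) = \int[mu]_(x in
    box a b) f x.
    rewrite [RHS]Rintegral_mkcond; apply: eq_Rintegral => x _.
    by rewrite patchE indicE; case: ifP => // _; rewrite ?mulr1 ?mul0r.
  have -> : (fun k => \int[mu]_x ((f \_ (box a b)) x * prodf (g k) x)) = L \o g.
    apply/funext => k; apply: eq_Rintegral => x _; rewrite patchE.
    case: ifPn => // /negP xab; rewrite out ?mulr0// => xab'; apply: xab.
    exact/mem_set.
  apply.
  - by move=> k; apply: measurable_prodf => i; case: (tg k i).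
  - by apply: measurable_indic; exact: measurable_box.
  - move=> k x; rewrite normr_prod; apply: prodr_ile1 => i _.
    by rewrite normr_ge0 plateau_bounded.
  - move=> x; have -> : \1_(box a b) x = \prod_i (\1_(`]a i, b i[%classic) (x
      ord0 i)) :> R.
      exact: indic_box.
    apply: cvg_big => [|i _]; first exact: mul_continuous.
    exact: plateau_cvg.
have cR : L (g k) @[k --> \oo] --> (\prod_i fine (leb `]a i, b i[)) * L (fun=>
  r).
  rewrite (_ : (fun k => _) = fun k => (\prod_i \int[leb]_t g k i t) * L (fun=>
    r)).
    apply: cvgMr_tmp; apply: cvg_big => [|i _]; first exact: mul_continuous.
    exact: plateau_int_cvg.
  by apply/funext => k; rewrite (L_mean (tg k) tr r1).
by apply: cvg_unique cL cR.
Qed.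

(** The constant is the mean of [f] against the product of unit-mass functions. By [L_box], [f]
    minus this constant integrates to zero over each nonempty box, and [ae_eq0_boxes] applies. *)
Lemma zero_weak_gradient : exists c, \forall x \ae mu, f x = c.
Proof.
have [r tr r1] := test1_unit_mass R.
exists (L (fun=> r)); set c := L _; have [mf _] := lf.
have ic a b : mu.-integrable (box a b) (EFin \o (cst c)).
  apply/integrableP; split; first by apply/measurable_EFinP.
  have -> : (\int[mu]_(x in box a b) `|(EFin \o cst c) x| =
      `|c|%:E * mu (box a b))%E.
    by rewrite -integral_cst//; exact: measurable_box.
  by rewrite mu_box -EFinM ltry.
have ifc a b : mu.-integrable (box a b) (EFin \o (fun x => f x - c)).
  have -> : EFin \o (fun x => f x - c) = ((EFin \o f) \- (EFin \o (cst c)))%E.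
    by apply/funext => x; rewrite /= EFinB.
  by apply: integrableB => //;
    [exact: measurable_box|exact: loc_integrable_box].
suff : \forall x \ae mu, f x - c = 0.
  by apply: filterS => x /eqP; rewrite subr_eq0 => /eqP.
apply: ae_eq0_boxes.
- exact: measurable_funB.
- by move=> k; exact: ifc.
- move=> a b; have [[i ba]|ab] := pselect (exists i, b i <= a i).
    by rewrite (box0 ba) integral_set0.
  have {}ab i : a i < b i.
    by rewrite ltNge; apply/negP => ba; apply: ab; exists i.
  have mB := @measurable_box R n a b.
  rewrite -[LHS]fineK; last exact: integrable_fin_num.
  rewrite -[fine _]/(Rintegral _ _ _) RintegralB//;
    last exact: loc_integrable_box.
  rewrite (L_box tr r1 ab) Rintegral_cst//.
  rewrite [X in _ - _ * X](_ : _ = \prod_i fine (leb `]a i, b i[)).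
    by rewrite mulrC subrr.
  exact: (congr1 fine (mu_box a b)).
Qed.

End proof.
End zero_weak_gradient.

(** * Continuously differentiable functions *)

Lemma rV_norm_lt (R : realType) n (v : 'rV[R]_n) e :
  0 < e -> (forall i, `|v ord0 i| < e) -> `|v| < e.
Proof.
by move=> e0 ve; rewrite [ltLHS]mx_normrE bigmax_lt// => -[j i] _; rewrite ord1.
Qed.

Lemma rV_norm_le (R : realType) n (v : 'rV[R]_n) e :
  0 <= e -> (forall i, `|v ord0 i| <= e) -> `|v| <= e.
Proof.
by move=> e0 ve; rewrite [leLHS]mx_normrE bigmax_le// => -[j i] _; rewrite ord1.
Qed.

(** The measurable sets are defined from the coordinates and not from the topology. The link is that
    an open set is the union of the boxes with rational corners that it contains, of which there are
    countably many. *)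
Lemma open_measurable_rV (R : realType) n (W : set 'rV[R]_n) :
  open W -> measurable W.
Proof.
move=> oW; pose I := ({ffun 'I_n -> rat} * {ffun 'I_n -> rat})%type.
pose B (c : I) : set 'rV[R]_n := box (fun i => ratr (c.1 i)) (fun i =>
  ratr (c.2 i)).
have -> : W = \bigcup_(c in [set c : I | B c `<=` W]) B c.
  apply/seteqP; split => [x Wx|x [c cW]]; last exact: cW.
  have /nbhs_normP[e /= e0 eW] := open_nbhs_nbhs (conj oW Wx).
  have ha i : {a : rat | ratr a \in `]x ord0 i - e, x ord0 i[}.
    by apply/cid/rat_in_itvoo; rewrite gtrDl oppr_lt0.
  have hb i : {b : rat | ratr b \in `]x ord0 i, x ord0 i + e[}.
    by apply/cid/rat_in_itvoo; rewrite ltrDl.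
  exists ([ffun i => sval (ha i)], [ffun i => sval (hb i)]) => /=.
    move=> y By; apply: eW; rewrite /=; apply: rV_norm_lt => // i.
    rewrite !mxE ltr_distlC; have := By i; rewrite /= !ffunE in_itv/=.
    have := svalP (ha i); have := svalP (hb i); rewrite !in_itv/=.
    by move=> /andP[? ?] /andP[? ?] /andP[? ?]; apply/andP; split; lra.
  move=> i /=; rewrite !ffunE in_itv/=.
  have := svalP (ha i); have := svalP (hb i); rewrite !in_itv/=.
  by move=> /andP[? ?] /andP[? ?]; apply/andP.
rewrite bigcup_mkcond; apply: countable_bigcupT_measurable => [|c].
  exact: countableP.
by case: ifP => // _; exact: measurable_box.
Qed.

Section c1_functions.
Variables (R : realType) (n : nat).
Implicit Types (f : 'rV[R]_n -> R^o) (x y : 'rV[R]_n).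

Lemma is_derive_line f x i (s : R) :
  derivable f (x + s *: delta_mx ord0 i) (delta_mx ord0 i) ->
  is_derive s (1 : R) ((fun t => f (x + t *: delta_mx ord0 i)) : R -> R)
    (pder i f (x + s *: delta_mx ord0 i)).
Proof.
move=> df.
have E : (fun h : R => h^-1 *: (f (x + (h *: 1 + s) *: delta_mx ord0 i) -
    f (x + s *: delta_mx ord0 i))) =
  (fun h : R => h^-1 *: (f (h *: delta_mx ord0 i + (x + s *: delta_mx ord0 i)) -
    f (x + s *: delta_mx ord0 i))).
  apply/funext => h; congr (_ *: (f _ - _)).
  by rewrite [h *: 1]mulr1 scalerDl addrCA.
split; first by rewrite /derivable E.
by rewrite /derive E.
Qed.

(** The increment [d] may have either sign or vanish, so the intermediate point is located by its
    absolute value only. *)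
Lemma mvt_line (g : R -> R) (dg : R -> R) (d : R) :
  (forall s, `|s| <= `|d| -> is_derive s (1 : R) g (dg s)) ->
  exists2 s, `|s| <= `|d| & g d - g 0 = dg s * d.
Proof.
move=> dg_; have cg s : `|s| <= `|d| -> {for s, continuous g}.
  move=> /dg_[dgs _]; exact/differentiable_continuous/derivable1_diffP.
have [d0|d0|->] := ltgtP d 0; last by exists 0; rewrite ?normr0// subrr mulr0.
- have [||s] := @MVT R g dg d 0 d0.
  + move=> s; rewrite in_itv/= => /andP[ds s0]; apply: dg_.
    by rewrite !ltr0_norm// lerN2 ltW.
  + apply: continuous_in_subspaceT => s; rewrite inE/= in_itv/= => /andP[ds s0].
    by apply: cg; rewrite ler0_norm// ltr0_norm// lerN2.
  rewrite in_itv/= => /andP[ds s0] E; exists s.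
    by rewrite !ltr0_norm// lerN2 ltW.
  by rewrite -opprB E sub0r mulrN opprK.
- have [||s] := @MVT R g dg 0 d d0.
  + move=> s; rewrite in_itv/= => /andP[s0 ds]; apply: dg_.
    by rewrite !gtr0_norm// ltW.
  + apply: continuous_in_subspaceT => s; rewrite inE/= in_itv/= => /andP[s0 ds].
    by apply: cg; rewrite ger0_norm// gtr0_norm.
  rewrite in_itv/= => /andP[s0 sd] E; exists s.
    by rewrite !gtr0_norm// ltW.
  by rewrite E subr0.
Qed.

(* Move from x to y one coordinate at a time and use the mean value theorem on
   each segment. *)
Lemma c1_expansion f x :
  (forall i, \forall y \near x, derivable f y (delta_mx ord0 i)) ->
  (forall i, {for x, continuous (pder i f)}) ->
  forall e : R, 0 < e -> \forall y \near x,
    `|f y - f x - \sum_i (y - x) ord0 i * pder i f x| <= e * `|y - x|.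
Proof.
move=> df cf e e0.
(* Each of the [n] coordinate steps may cost this much times |y - x|; the successor keeps the
   quotient meaningful for n = 0. *)
have en0 : 0 < e / n.+1%:R by rewrite divr_gt0.
pose P i w := derivable f w (delta_mx ord0 i) /\
    `|pder i f w - pder i f x| <= e / n.+1%:R.
have H : \forall w \near x, forall i, P i w.
  apply: (@filter_forall _ _ P (nbhs x)) => i; apply: filterI; first exact: df.
  by have /cvgrPdistC_le := cf i; apply.
have /nbhs_normP[d /= d0 dH] := H.
apply/nbhs_normP; exists d => //= y xy.
pose z k : 'rV[R]_n := \row_i if (i < k)%N then y ord0 i else x ord0 i.
have z0 : z 0 = x by apply/rowP => i; rewrite mxE.
have zn : z n = y by apply/rowP => i; rewrite mxE ltn_ord.
have -> : f y - f x = \sum_(i < n) (f (z i.+1) - f (z i)).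
  rewrite -[in LHS]zn -[in LHS]z0.
  rewrite -(telescope_sumr (fun k => f (z k)) (leq0n n)) big_mkord//.
rewrite -sumrB (le_trans (ler_norm_sum _ _ _))//.
apply: (@le_trans _ _ (\sum_(i < n) (e / n.+1%:R * `|y - x|))); last first.
  rewrite sumr_const card_ord -[leLHS]mulr_natr mulrAC ler_wpM2r//.
  by rewrite -mulrA ger_pMr// mulrC ler_pdivrMr// mul1r ler_nat.
apply: ler_sum => i _.
have zS : z i.+1 = z i + (y - x) ord0 i *: delta_mx ord0 i.
  apply/rowP => j; rewrite !mxE eqxx/= ltnS leq_eqVlt -val_eqE/=.
  case: (ltngtP j i) => [ji|ij|/val_inj ->]; rewrite ?mulr0 ?addr0//.
  by rewrite mulr1 addrC subrK.
have yxi := ler_coord_norm (y - x) i.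
(* The norm is the sup norm, so a point on any of the segments is no farther from [x] than [y] is
   and stays in the ball where [P] holds. *)
have zd s : `|s| <= `|(y - x) ord0 i| -> `|x - (z i + s *: delta_mx ord0 i)| <
  d.
  move=> sd; apply: le_lt_trans xy; rewrite distrC.
  apply: rV_norm_le => // k; rewrite !mxE eqxx/=.
  have yxk := ler_coord_norm (y - x) k; rewrite !mxE in yxk.
  rewrite -val_eqE/=; case: (ltngtP k i) => [ki|ik|/val_inj ->].
  - by rewrite mulr0 addr0 [leRHS]distrC.
  - by rewrite mulr0 addr0 subrr normr0 normr_ge0.
  - by rewrite mulr1 addrAC subrr add0r [leRHS]distrC (le_trans sd).
have [s sd] := @mvt_line (fun t => f (z i + t *: delta_mx ord0 i))
  (fun t => pder i f (z i + t *: delta_mx ord0 i)) ((y - x) ord0 i)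
  (fun s sd => is_derive_line (dH _ (zd s sd) i).1).
rewrite scale0r addr0 -zS => ->; rewrite [X in _ - X]mulrC -mulrBl normrM.
by rewrite ler_pM//; exact: (dH _ (zd s sd) i).2.
Qed.

(** A chain rule is needed because [smooth_on] speaks of partial derivatives, whereas tangent
    vectors are velocities of curves. The expansion of [f] at [x] is evaluated at [gam h] and
    divided by [h]. *)
Lemma is_derive_c1_comp f x (gam : R^o -> 'rV[R]_n) (v : 'rV[R]_n) :
  (forall i, \forall y \near x, derivable f y (delta_mx ord0 i)) ->
  (forall i, {for x, continuous (pder i f)}) ->
  gam 0 = x -> is_derive (0 : R^o) (1 : R^o) gam v ->
  is_derive (0 : R^o) (1 : R^o) (f \o gam) (\sum_i v ord0 i * pder i f x).
Proof.
move=> df cf g0 dg; pose l (w : 'rV[R]_n) := \sum_i w ord0 i * pder i f x.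
have cg : gam h @[h --> (0 : R)] --> x.
  rewrite -g0; apply: differentiable_continuous; apply/derivable1_diffP.
  by case: dg.
pose q (h : R) := h^-1 *: (gam h - x).
have qv : q h @[h --> (0 : R)^'] --> v.
  have E : (fun h : R => h^-1 *: (gam (h *: 1 + 0) - gam 0)) = q.
    by apply/funext => h; rewrite /q addr0 [h *: 1]mulr1 g0.
  by have [d <-] := dg; move: d; rewrite /derivable /derive E.
have lqv : l (q h) @[h --> (0 : R)^'] --> l v.
  apply: cvg_big => [|i _]; first exact: add_continuous.
  apply: cvgMr_tmp.
  apply: (@cvg_comp _ _ _ q (fun w : 'rV[R]_n => w ord0 i) _ (nbhs v)) => //.
  exact: coord_continuous.
have L : h^-1 *: (f (gam (h *: 1 + 0)) - f (gam 0)) @[h --> (0 : R)^'] --> (l v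
  : R^o).
  apply: cvg_sub0 lqv; apply/cvgr0Pnorm_le => e e0.
  (* The quotients [q h] tend to [v], so their norm is eventually at most |v| + 1, which this choice
     cancels. *)
  have en0 : 0 < e / (`|v| + 1) by rewrite divr_gt0// ltr_wpDl.
  have H := cg _ (c1_expansion df cf en0).
  near=> h.
  have h0 : h != 0 by near: h; exact: nbhs_dnbhs_neq.
  rewrite /= !fctE addr0 [h *: 1]mulr1 g0.
  have -> : h^-1 *: (f (gam h) - f x) - l (q h) =
      h^-1 *: (f (gam h) - f x - l (gam h - x)).
    rewrite [RHS]scalerBr; congr (_ - _); rewrite /l scaler_sumr;
      apply: eq_bigr => i _.
    by rewrite /q mxE -mulrA.
  rewrite normrZ normfV ler_pdivrMl ?normr_gt0//.
  apply: (@le_trans _ _ (e / (`|v| + 1) * `|gam h - x|)).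
    by near: h; exact: (nbhs_dnbhs H).
  have -> : gam h - x = h *: q h by rewrite /q scalerA divff// scale1r.
  rewrite normrZ mulrCA ler_wpM2l// -mulrA ger_pMr// ler_pdivrMl ?ltr_wpDl//
    mulr1.
  near: h; have : `|q h| @[h --> (0 : R)^'] --> `|v| by exact: cvg_norm.
  by move=> /(cvgr_le `|v|); apply; rewrite ltrDl.
by split; [apply/cvg_ex; exists (l v)|apply/cvg_lim].
Unshelve. all: by end_near. Qed.

End c1_functions.

(** * Tangent spaces in slice charts *)

Section row_vectors.
Variable R : realType.

Lemma dotvE q (u v : 'rV[R]_q) : dotv u v = (u *m v^T) ord0 ord0.
Proof. by rewrite mxE; apply: eq_bigr => i _; rewrite mxE. Qed.

Lemma dotv_ge0 q (u : 'rV[R]_q) : 0 <= dotv u u.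
Proof. by apply: sumr_ge0 => i _; rewrite -expr2 sqr_ge0. Qed.

Lemma dotv_eq0 q (u : 'rV[R]_q) : dotv u u = 0 -> u = 0.
Proof.
move=> /eqP; rewrite psumr_eq0 => [/allP u0|i _];
  last by rewrite -expr2 sqr_ge0.
apply/rowP => i; rewrite mxE; apply/eqP; rewrite -sqrf_eq0 expr2.
exact: (u0 i (mem_index_enum i)).
Qed.

Lemma dotvBl q (u v w : 'rV[R]_q) : dotv (u - v) w = dotv u w - dotv v w.
Proof. by rewrite -sumrB; apply: eq_bigr => i _; rewrite !mxE mulrBl. Qed.

Lemma is_derive_row q (gam : R^o -> 'rV[R]_q) (t : R^o) (v : 'rV[R]_q) :
  (forall j, is_derive t (1 : R^o) (fun s => gam s ord0 j : R^o) (v ord0 j)) ->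
  is_derive t (1 : R^o) gam v.
Proof.
move=> dg; have dgam : derivable gam t (1 : R^o).
  by apply/derivable_mxP => i j; rewrite ord1; case: (dg j).
split=> //; rewrite derive_mx//; apply/rowP => j; rewrite mxE.
by case: (dg j).
Qed.

Lemma is_derive_coord q (gam : R^o -> 'rV[R]_q) (t : R^o) (v : 'rV[R]_q) j :
  is_derive t (1 : R^o) gam v ->
  is_derive t (1 : R^o) (fun s => gam s ord0 j : R^o) (v ord0 j).
Proof.
move=> [dg <-]; split; first by move/derivable_mxP : dg.
by rewrite derive_mx// mxE.
Qed.

Lemma is_derive_unique q (gam : R^o -> 'rV[R]_q) (t : R^o) (v w : 'rV[R]_q) :
  is_derive t (1 : R^o) gam v -> is_derive t (1 : R^o) gam w -> v = w.
Proof. by move=> [_ <-] [_ <-]. Qed.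

End row_vectors.

(** * Orthogonal projection onto a row space *)

Section gram_projector.
Variables (R : realType) (q n : nat).
Hypothesis nq : (n <= q)%N.
Implicit Type J : 'M[R]_q.

(* The row space of pid_mx n *m J is spanned by the first n rows of J; adding
   copid_mx n makes its (singular) Gram matrix invertible. *)
Definition frame J : 'M[R]_q := pid_mx n *m J.
Definition gram J : 'M[R]_q := frame J *m (frame J)^T + copid_mx n.
(** The classical A^T G^-1 A. The inverse is written through determinant and adjugate, so that its
    continuity follows from that of the entries. *)
Definition gram_proj J : 'M[R]_q :=
  (frame J)^T *m ((\det (gram J))^-1 *: \adj (gram J)) *m frame J.

Let copid_frame J : copid_mx n *m frame J = 0.
Proof. by rewrite /frame mulmxA mul_copid_mx_pid// mul0mx. Qed.

Let tr_copid : (copid_mx n : 'M[R]_q)^T = copid_mx n.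
Proof. by rewrite /copid_mx linearB/= trmx1 tr_pid_mx. Qed.

Let frame_copid J : (frame J)^T *m copid_mx n = 0.
Proof. by rewrite -tr_copid -trmx_mul copid_frame trmx0. Qed.

(** With A the frame and c = [copid_mx n], symmetric and idempotent, w G w^T = |w A|^2 + |w c|^2. If
    w G = 0, then w A = 0 gives w [pid_mx n] = 0 by invertibility of [J], and w c = 0 gives that the
    rest of w vanishes. *)
Lemma gram_unit J : J \in unitmx -> gram J \in unitmx.
Proof.
move=> uJ; rewrite -row_free_unit; apply: inj_row_free => w wG.
have : dotv (w *m frame J) (w *m frame J) +
       dotv (w *m copid_mx n) (w *m copid_mx n) = 0.
  have cc : copid_mx n *m copid_mx n = copid_mx n :> 'M[R]_q by exact:
    copid_mx_id.
  have E : w *m frame J *m (w *m frame J)^T +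
      w *m copid_mx n *m (w *m copid_mx n)^T = w *m gram J *m w^T.
    have -> : w *m gram J = w *m (frame J *m (frame J)^T) + w *m copid_mx n.
      exact: mulmxDr.
    rewrite [RHS]mulmxDl !trmx_mul tr_copid !mulmxA.
    by rewrite -[_ *m copid_mx n *m copid_mx n]mulmxA cc.
  have := congr1 (fun M : 'M[R]_1 => M ord0 ord0) E.
  by rewrite wG mul0mx [X in X = _]mxE [X in _ = X]mxE !dotvE.
move/eqP; rewrite paddr_eq0 ?dotv_ge0// =>
  /andP[/eqP/dotv_eq0 wA /eqP/dotv_eq0 wc].
have wp : w *m (pid_mx n : 'M[R]_q) = 0.
  by rewrite -[LHS](mulmxK uJ) -[_ *m _ *m J]mulmxA -/(frame J) wA mul0mx.
by move: wc; rewrite /copid_mx mulmxBr mulmx1 wp subr0.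
Qed.

(** Since A^T c = 0, one has G c = c and so G^-1 c = c. Hence A^T G^-1 A A^T = A^T G^-1 (G - c) =
    A^T, which is the orthogonality of the residual to the rows of A. *)
Lemma gram_projP J v : J \in unitmx ->
  (exists u, v *m gram_proj J = u *m frame J) /\
  forall u, dotv (v - v *m gram_proj J) (u *m frame J) = 0.
Proof.
move=> /gram_unit uG; rewrite /gram_proj.
have -> : (\det (gram J))^-1 *: \adj (gram J) = invmx (gram J).
  by rewrite /invmx uG.
split=> [|u]; first by eexists; rewrite !mulmxA.
have Gc : invmx (gram J) *m copid_mx n = copid_mx n.
  apply: (can_inj (mulKmx uG)); rewrite mulKVmx// /gram mulmxDl -mulmxA.
  by rewrite frame_copid mulmx0 add0r; exact/esym/copid_mx_id.
have AA : frame J *m (frame J)^T = gram J - copid_mx n by rewrite addrK.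
have K : (v - v *m ((frame J)^T *m invmx (gram J) *m frame J)) *m (frame J)^T =
  0.
  have -> : (v - v *m ((frame J)^T *m invmx (gram J) *m frame J)) *m (frame J)^T
      = v *m (frame J)^T -
        v *m ((frame J)^T *m (invmx (gram J) *m (frame J *m (frame J)^T))).
    by rewrite mulmxBl !mulmxA.
  by rewrite AA mulmxBr mulVmx// Gc mulmxBr mulmx1 frame_copid subr0 subrr.
by rewrite dotvE [(u *m _)^T]trmx_mul [_ *m (_ *m u^T)]mulmxA K mul0mx mxE.
Qed.

End gram_projector.

Section smooth_maps.
Variables (R : realType) (q : nat).
Implicit Types (F : 'rV[R]_q -> 'rV[R]_q) (U : set 'rV[R]_q).

(** The transpose of the usual Jacobian matrix: row [i] is the derivative along the i-th basis
    vector, and the differential acts on row vectors by right multiplication. *)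
Definition jac F (x : 'rV[R]_q) : 'M[R]_q := \matrix_(i, j) pder i F x ord0 j.

Lemma smooth_continuous U F x : smooth_on U F -> U x -> {for x, continuous F}.
Proof. by move=> sF Ux; have [] := sF [::] x Ux. Qed.

Lemma pder_coord U F i j y : smooth_on U F -> U y ->
  pder i (fun z => F z ord0 j : R^o) y = jac F y i j.
Proof.
move=> sF Uy; have [_ /(_ i) dF] := sF [::] y Uy.
by rewrite mxE /pder derive_mx// mxE.
Qed.

Lemma jac_continuous U F i j x : open U -> smooth_on U F -> U x ->
  {for x, continuous (fun y => jac F y i j : R^o)}.
Proof.
move=> oU sF Ux; have [c _] := sF [:: i] x Ux.
rewrite (_ : (fun y => _) = (fun M : 'rV[R]_q => M ord0 j) \o pder i F).
  by apply: continuous_comp; [exact: c|exact: coord_continuous].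
by apply/funext => y; rewrite mxE.
Qed.

Lemma is_derive_smooth U F x (gam : R^o -> 'rV[R]_q) v :
  open U -> smooth_on U F -> U x -> gam 0 = x ->
  is_derive (0 : R^o) (1 : R^o) gam v ->
  is_derive (0 : R^o) (1 : R^o) (F \o gam) (v *m jac F x).
Proof.
move=> oU sF Ux g0 dg; apply: is_derive_row => j.
have nU : \forall y \near x, U y := open_nbhs_nbhs (conj oU Ux).
have -> : (v *m jac F x) ord0 j =
    \sum_i v ord0 i * pder i (fun z => F z ord0 j : R^o) x.
  by rewrite mxE; apply: eq_bigr => i _; rewrite (pder_coord _ _ sF).
apply: (@is_derive_c1_comp R q (fun z => F z ord0 j : R^o) x gam v) => // i.
  near=> y; have Uy : U y by near: y.
  by have [_ /(_ i) /derivable_mxP] := sF [::] y Uy; apply.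
rewrite /prop_for /continuous_at (pder_coord _ _ sF)//.
have J := jac_continuous (i := i) (j := j) oU sF Ux.
have E : {near x, (fun y => jac F y i j : R^o) =1
    pder i (fun z => F z ord0 j : R^o)}.
  by apply: filterS nU => y Uy; rewrite (pder_coord _ _ sF).
exact: (cvg_trans (near_eq_cvg E) J).
Unshelve. all: by end_near. Qed.

End smooth_maps.

Lemma is_derive_affine (R : realType) q (y w : 'rV[R]_q) :
  is_derive (0 : R^o) (1 : R^o) (fun t : R^o => y + t *: w) w.
Proof.
apply: is_derive_row => j.
rewrite (_ : (fun s => _) = (cst (y ord0 j) + w ord0 j \*: id :> (R^o -> R^o))).
  by apply: is_derive_eq; rewrite add0r [_ *: _]mulr1.
by apply/funext => s; rewrite !mxE fctE/= [_ *: _]mulrC.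
Qed.

Lemma cvg_affine (R : realType) q (y w : 'rV[R]_q) :
  (y + t *: w) @[t --> (0 : R^o)] --> y.
Proof.
have : {for (0 : R^o), continuous (fun t : R^o => y + t *: w)}.
  apply/differentiable_continuous/derivable1_diffP.
  by have [] := is_derive_affine y w.
by rewrite /prop_for /continuous_at scale0r addr0.
Qed.

(** * Tangent space and tangential projection in a slice chart *)

Section chart.
Variables (R : realType) (q n : nat) (N U V : set 'rV[R]_q).
Variables Phi Psi : 'rV[R]_q -> 'rV[R]_q.
Hypotheses (nq : (n <= q)%N) (oU : open U) (oV : open V).
Hypotheses (sPhi : smooth_on U Phi) (sPsi : smooth_on V Psi).
Hypotheses (PhiK : forall x, U x -> V (Phi x) /\ Psi (Phi x) = x).
Hypotheses (PsiK : forall y, V y -> U (Psi y) /\ Phi (Psi y) = y).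
Hypothesis slice : forall x, U x ->
  (N x <-> forall c : 'I_q, (n <= c)%N -> Phi x ord0 c = 0).

Lemma pid_mx_supp (w : 'rV[R]_q) :
  (w *m pid_mx n = w) <-> (forall c : 'I_q, (n <= c)%N -> w ord0 c = 0).
Proof.
have E c : (w *m (pid_mx n : 'M[R]_q)) ord0 c = if (c < n)%N then w ord0 c else
  0.
  rewrite mxE (bigD1 c)//= big1 ?addr0 => [|i ic].
    by rewrite mxE eqxx/=; case: ifP; rewrite ?mulr1 ?mulr0.
  by rewrite mxE (_ : (i == c :> nat) = false) ?mulr0//; exact/negbTE.
split=> [wn c nc|w0]; first by rewrite -wn E ltnNge nc.
by apply/rowP => c; rewrite E; case: ltnP => // nc; rewrite w0.
Qed.

(** A curve in [N] is carried by [Phi] into the slice, so its velocity there has no components of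
    index at least [n]; applying [Psi] recovers [v]. Conversely, [Psi] maps a straight line in the
    slice to a curve in [N] with the prescribed velocity. *)
Lemma tangent_chart x v : U x -> N x ->
  tangent N x v <-> exists u : 'rV[R]_q, v = u *m frame n (jac Psi (Phi x)).
Proof.
move=> Ux Nx; have [Vx PsiPhi] := PhiK Ux.
have /(slice Ux) Phi0 := Nx.
split=> [[gam [g0 gN dg]]|[u ->]].
  have dPg := is_derive_smooth oU sPhi Ux g0 dg.
  have cg : gam h @[h --> (0 : R^o)] --> x.
    rewrite -g0; apply: differentiable_continuous; apply/derivable1_diffP.
    by case: dg.
  have gU : \forall t \near (0 : R^o), U (gam t).
    exact: (cg _ (open_nbhs_nbhs (conj oU Ux))).
  exists (v *m jac Phi x);
    rewrite /frame mulmxA (_ : _ *m pid_mx n = v *m jac Phi x).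
    have dPPg := is_derive_smooth (gam := Phi \o gam) oV sPsi Vx (congr1 Phi
      g0) dPg.
    apply: (is_derive_unique dg); apply: near_eq_is_derive dPPg.
    near=> t; have Ut : U (gam t) by near: t.
    by have [_ /= ->] := PhiK Ut.
  apply/pid_mx_supp => c nc; have dc := is_derive_coord c dPg.
  have dc0 : is_derive (0 : R^o) (1 : R^o) (fun s =>
    (Phi \o gam) s ord0 c : R^o) 0.
    apply: (@near_eq_is_derive _ R^o R^o (cst 0) _ 0 1 0 _
      (is_derive_cst _ _ _)).
    near=> t; have Ut : U (gam t) by near: t.
    have /(slice Ut) : N (gam t) by near: t.
    by move=> /(_ c nc) /= ->.
  by case: dc => _ <-; case: dc0.
rewrite /frame mulmxA; set w := u *m pid_mx n.
exists (fun t : R^o => Psi (Phi x + t *: w)); split.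
- by rewrite scale0r addr0.
- have cl := @cvg_affine _ _ (Phi x) w.
  have lV : \forall t \near (0 : R^o), V (Phi x + t *: w).
    exact: (cl _ (open_nbhs_nbhs (conj oV Vx))).
  near=> t; have /PsiK[Ut Pt] : V (Phi x + t *: w) by near: t.
  have w0 : forall c : 'I_q, (n <= c)%N -> w ord0 c = 0.
    by apply/pid_mx_supp; rewrite /w -mulmxA pid_mx_id.
  by apply/(slice Ut) => c nc; rewrite Pt mxE Phi0// add0r mxE w0// mulr0.
- have := @is_derive_smooth R q V Psi (Phi x) (fun t : R^o =>
    Phi x + t *: w) w oV sPsi Vx.
  by apply; [rewrite scale0r addr0|exact: is_derive_affine].
Unshelve. all: by end_near. Qed.

(** Differentiating Phi o Psi = id along the coordinate lines through [Phi x] exhibits [jac Phi x]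
    as an inverse. *)
Lemma jac_unit x : U x -> jac Psi (Phi x) \in unitmx.
Proof.
move=> Ux; have [Vx PsiPhi] := PhiK Ux.
suff J1 : jac Psi (Phi x) *m jac Phi x = 1%:M by have [] := mulmx1_unit J1.
apply/row_matrixP => i; rewrite rowE mulmxA row1.
set e := delta_mx 0 i.
have d1 := @is_derive_smooth R q V Psi (Phi x) (fun t : R^o =>
  Phi x + t *: e) e oV sPsi Vx.
have {}d1 := d1 _ (is_derive_affine _ _).
have z0 : Phi x + 0 *: e = Phi x by rewrite scale0r addr0.
have {}d1 := d1 z0.
have d2 := is_derive_smooth oU sPhi Ux _ d1.
have {}d2 := d2 (etrans (congr1 Psi z0) PsiPhi).
apply: (is_derive_unique d2).
apply: near_eq_is_derive (is_derive_affine (Phi x) e).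
have cl := @cvg_affine _ _ (Phi x) e.
have lV : \forall t \near (0 : R^o), V (Phi x + t *: e).
  exact: (cl _ (open_nbhs_nbhs (conj oV Vx))).
near=> t; have /PsiK[Ut Pt] : V (Phi x + t *: e) by near: t.
by rewrite /= Pt.
Unshelve. all: by end_near. Qed.

(** [gram_proj] shows that the specification behind [get] is satisfiable. Two solutions agree: on a
    basis vector their difference is tangent, because the tangent vectors form a row space, and it
    is orthogonal to every tangent vector, hence to itself. *)
Lemma tproj_chart x : U x -> N x ->
  tproj N x = gram_proj n (jac Psi (Phi x)).
Proof.
move=> Ux Nx; have uJ := jac_unit Ux; set J := jac Psi (Phi x) in uJ *.
have tJ v : tangent N x v <-> exists u : 'rV[R]_q, v = u *m frame n J.
  exact: tangent_chart.
have gP (v : 'rV[R]_q) : tangent N x (v *m gram_proj n J) /\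
    forall w, tangent N x w -> dotv (v - v *m gram_proj n J) w = 0.
  have [vP vPw] := gram_projP nq v uJ; split; first exact/tJ.
  by move=> w /tJ[u ->]; exact: vPw.
rewrite /tproj; set S := [set P : 'M[R]_q | _].
have tP : S (get S) by apply: getPex; exists (gram_proj n J).
apply/row_matrixP => i; rewrite !rowE; set v := delta_mx 0 i.
apply/eqP; rewrite -subr_eq0; apply/eqP/dotv_eq0.
have [/tJ[u1 E1] O1] := tP v; have [/tJ[u2 E2] O2] := gP v.
have tD : tangent N x (v *m get S - v *m gram_proj n J).
  by apply/tJ; exists (u1 - u2); rewrite mulmxBl -E1 -E2.
rewrite -[X in dotv X _](_ : (v - v *m gram_proj n J) - (v - v *m get S) = _).
  by rewrite dotvBl O1// O2// subrr.
by rewrite opprB addrC addrA subrK.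
Qed.

End chart.

(** * Measurability of the tangential projection *)

Section matrix_cvg.
Variables (R : realType) (T : Type) (F : set_system T).
Context {FF : Filter F}.

(** Convergence is taken entry by entry, so that products, determinants and adjugates reduce to
    finite sums and products of real limits. *)
Definition mcvg m n (A : T -> 'M[R]_(m, n)) (A0 : 'M[R]_(m, n)) :=
  forall i j, A t i j @[t --> F] --> A0 i j.

Lemma mcvg_cst m n (A : 'M[R]_(m, n)) : mcvg (fun=> A) A.
Proof. by move=> i j; exact: cvg_cst. Qed.

Lemma mcvg_tr m n (A : T -> 'M[R]_(m, n)) A0 :
  mcvg A A0 -> mcvg (fun t => (A t)^T) A0^T.
Proof.
by move=> cA i j; rewrite mxE; under eq_fun do rewrite mxE; exact: cA.
Qed.

Lemma mcvg_add m n (A B : T -> 'M[R]_(m, n)) A0 B0 :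
  mcvg A A0 -> mcvg B B0 -> mcvg (fun t => A t + B t) (A0 + B0).
Proof.
move=> cA cB i j; rewrite mxE; under eq_fun do rewrite mxE.
by apply: cvgD; [exact: cA|exact: cB].
Qed.

Lemma mcvg_scale m n (c : T -> R) (c0 : R) (A : T -> 'M[R]_(m, n)) A0 :
  c t @[t --> F] --> c0 -> mcvg A A0 -> mcvg (fun t => c t *: A t) (c0 *: A0).
Proof.
move=> cc cA i j; rewrite mxE; under eq_fun do rewrite mxE.
by apply: cvgM; [exact: cc|exact: cA].
Qed.

Lemma mcvg_mul m n p (A : T -> 'M[R]_(m, n)) (B : T -> 'M[R]_(n, p)) A0 B0 :
  mcvg A A0 -> mcvg B B0 -> mcvg (fun t => A t *m B t) (A0 *m B0).
Proof.
move=> cA cB i j; rewrite mxE; under eq_fun do rewrite mxE.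
apply: cvg_big => [|k _]; first exact: add_continuous.
by apply: cvgM; [exact: cA|exact: cB].
Qed.

Lemma mcvg_det n (A : T -> 'M[R]_n) A0 :
  mcvg A A0 -> \det (A t) @[t --> F] --> \det A0.
Proof.
move=> cA; apply: cvg_big => [|s _]; first exact: add_continuous.
apply: cvgMl_tmp; apply: cvg_big => [|k _]; first exact: mul_continuous.
exact: cA.
Qed.

Lemma mcvg_adj n (A : T -> 'M[R]_n) A0 :
  mcvg A A0 -> mcvg (fun t => \adj (A t)) (\adj A0).
Proof.
move=> cA i j; rewrite mxE; under eq_fun do rewrite mxE.
apply: cvgMl_tmp; apply: mcvg_det => k l.
by rewrite !mxE; under eq_fun do rewrite !mxE; exact: cA.
Qed.

Lemma mcvg_gram_proj q n (J : T -> 'M[R]_q) J0 : (n <= q)%N ->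
  J0 \in unitmx -> mcvg J J0 ->
  mcvg (fun t => gram_proj n (J t)) (gram_proj n J0).
Proof.
move=> nq uJ cJ.
have cf : mcvg (fun t => frame n (J t)) (frame n J0).
  by apply: mcvg_mul cJ; exact: mcvg_cst.
have cG : mcvg (fun t => gram n (J t)) (gram n J0).
  apply: mcvg_add; last exact: mcvg_cst.
  by apply: mcvg_mul => //; exact: mcvg_tr.
apply: mcvg_mul => //; apply: mcvg_mul; first exact: mcvg_tr.
apply: mcvg_scale; last exact: mcvg_adj.
apply: cvgV; last exact: mcvg_det.
by rewrite -unitfE -unitmxE; exact: gram_unit.
Qed.

End matrix_cvg.

(** * Measurability of the submanifold and of its projection *)

Section embedded.
Variables (R : realType) (q n : nat) (N : set 'rV[R]_q).
Hypothesis hN : embedded_submanifold n N.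

(* N is locally closed. *)
Lemma measurable_embedded : measurable N.
Proof.
pose W := [set x : 'rV[R]_q | exists U, [/\ open U, U x & closure N `&` U `<=`
  N]].
have oW : open W.
  rewrite openE => x [U [oU Ux NU]];
    apply: filterS (open_nbhs_nbhs (conj oU Ux)).
  by move=> y Uy; exists U.
have -> : N = closure N `&` W.
  apply/seteqP; split => [p Np|x [cx [U [oU Ux]]]]; last by apply.
  split; first exact: subset_closure.
  have [_ /(_ p Np)[U [V [Phi [Psi [[oU Up] oV [sPhi _] _ slice]]]]]] := hN.
  exists U; split=> // x [cx Ux]; apply/(slice _ Ux) => c nc.
  (* A nonzero slice coordinate at [x] stays nonzero nearby, but points of [N] arbitrarily close to
     [x] have it equal to zero. *)
  apply/eqP/negPn/negP => Phix.
  have cPhi : (fun y => Phi y ord0 c) y @[y --> x] --> Phi x ord0 c.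
    apply: (@continuous_comp _ _ _ Phi (fun M : 'rV[R]_q => M ord0 c)).
      exact: smooth_continuous sPhi Ux.
    exact: coord_continuous.
  have Phi_neq0 : \forall y \near x, Phi y ord0 c != 0.
    exact: (cvgr_neq0 _ cPhi).
  have := cx _ (filterI Phi_neq0 (open_nbhs_nbhs (conj oU Ux))).
  by move=> [y [Ny [/= /eqP + Uy]]]; apply; exact: (slice _ Uy).1.
apply: measurableI; last exact: open_measurable_rV.
rewrite -[X in measurable X]setCK; apply: measurableC;
  apply: open_measurable_rV.
exact/closed_openC/closed_closure.
Qed.

(** A curve witnessing tangency at [p] starts in [N], so off [N] no vector is tangent, the
    specification is empty and [get] returns one default matrix for all such points. *)
Lemma tproj_out p : ~ N p -> tproj N p = get set0.
Proof.
move=> Np; rewrite /tproj; congr get; rewrite -subset0 =>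
  P /(_ 0)[[gam [g0 gN _]] _].
by apply: Np; rewrite -g0; exact: nbhs_singleton gN.
Qed.

Lemma measurable_tproj a b :
  measurable_fun [set: 'rV[R]_q] (fun p => tproj N p a b : R).
Proof.
have mN := measurable_embedded.
rewrite -(setUv N); apply/measurable_funU => //; first exact: measurableC.
split; last first.
  apply: (eq_measurable_fun (cst ((get set0 : 'M[R]_q) a b))) => [p|].
    by rewrite inE => Np; rewrite tproj_out.
  exact: measurable_cst.
apply: (measurability _ (RGenOInfty.measurableE R)) => _ [_ [c ->] <-].
(* Continuity holds only along [N]. Putting membership in [N] as a premise turns the relatively open
   superlevel set into the trace on [N] of an honest open set. *)
pose W := interior [set p | N p -> c < tproj N p a b].
rewrite [X in measurable X](_ : _ = N `&` W).
  apply: measurableI => //; apply: open_measurable_rV; exact: open_interior.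
apply/seteqP; split => [p [Np /=]|p [Np /interior_subset/(_ Np) cp]];
  last first.
  by split => //=; rewrite in_itv/= andbT.
rewrite in_itv/= andbT => cp; split=> //.
have [nq /(_ p Np)[U [V [Phi [Psi [[oU Up] oV]]]]]] := hN.
move=> [sPhi PhiK] [sPsi PsiK] slice.
have tE x : U x -> N x -> tproj N x = gram_proj n (jac Psi (Phi x)).
  by move=> Ux Nx; exact: (tproj_chart nq oU oV sPhi sPsi PhiK PsiK slice).
have cJ : mcvg (nbhs p) (fun x => jac Psi (Phi x)) (jac Psi (Phi p)).
  move=> i j; have [Vp _] := PhiK _ Up.
  apply: (@continuous_comp _ _ _ Phi (fun y => jac Psi y i j : R^o)).
    exact: smooth_continuous sPhi Up.
  exact: jac_continuous oV sPsi Vp.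
have uJ := jac_unit oU oV sPhi sPsi PhiK PsiK Up.
have /(_ a b) cP : mcvg (nbhs p) (fun x => gram_proj n (jac Psi (Phi x)))
    (gram_proj n (jac Psi (Phi p))) by exact: mcvg_gram_proj.
rewrite (tE p Up Np) in cp.
have nc := cvgr_gt _ cP _ cp.
near=> x => Nx; have Ux : U x by near: x; exact: open_nbhs_nbhs.
by rewrite (tE x Ux Nx); near: x; exact: nc.
Unshelve. all: by end_near. Qed.

End embedded.

(** * The trace of the stress-energy tensor *)

Section smooth_scaling.
Variable R : realType.
Implicit Types (g : R -> R) (a t : R).

Lemma is_derive_scale g a t : smooth1 g ->
  is_derive t (1 : R) (fun s => g (a * s)) (a * derive1 g (a * t)).
Proof.
move=> sg; rewrite mulrC.
apply: (@is_derive1_comp R g (a \*: id) t); first exact: smooth1_is_derive.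
by apply: is_derive_eq; exact: mulr1.
Qed.

Lemma smooth1_scale g a : smooth1 g -> smooth1 (fun t => g (a * t)).
Proof.
move=> sg.
(* The factor [b] collects the powers of [a] produced by the chain rule, which makes the class
   stable under differentiation. *)
apply: (@smooth1_coind _ [set f | exists b h, smooth1 h /\ f = fun t =>
  b * h (a * t)]).
  move=> _ [b [h [sh ->]]]; exists (fun t => b * a * derive1 h (a * t)).
    by exists (b * a), (derive1 h); split; [exact: smooth1_derive|].
  move=> t; have := is_deriveZ b (is_derive_scale a t sh).
  by rewrite [_ *: _]mulrA; exact.
by exists 1, g; split=> //; apply/funext => t; rewrite mul1r.
Qed.

Lemma test1_scale g a : 0 < a -> test1 g -> test1 (fun t => g (a * t)).
Proof.
move=> a0 [sg [M gM]]; split; first exact: smooth1_scale.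
exists (a^-1 * M) => t Mt; apply: gM.
by rewrite normrM gtr0_norm// -ltr_pdivrMl.
Qed.

End smooth_scaling.

Section dot_product.
Variables (R : realType) (q : nat).
Implicit Types u v : 'rV[R]_q.

Lemma dotv_suml m (u : 'I_m -> 'rV[R]_q) v :
  \sum_i dotv (u i) v = dotv (\sum_i u i) v.
Proof.
rewrite /dotv exchange_big; apply: eq_bigr => c _.
by rewrite summxE mulr_suml.
Qed.

Lemma dotv_young u v : `|dotv u v| <= dotv u u + dotv v v.
Proof.
rewrite /dotv -big_split/= (le_trans (ler_norm_sum _ _ _))//.
apply: ler_sum => c _; rewrite ler_norml; apply/andP; split; nra.
Qed.

(** Summing [dotv_young] over all pairs of indices gives the constant 2m. Its size is immaterial:
    the bound only carries square integrability from the Hessian to the tension field. *)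
Lemma dotv_sum_le m (u : 'I_m -> 'rV[R]_q) :
  dotv (\sum_i u i) (\sum_i u i) <= m%:R * \sum_i (2 * dotv (u i) (u i)).
Proof.
rewrite -dotv_suml.
have E i : dotv (u i) (\sum_j u j) = \sum_j dotv (u i) (u j).
  have C w z : dotv w z = dotv z w :> R by apply: eq_bigr => c _; rewrite mulrC.
  by rewrite C -dotv_suml; apply: eq_bigr => j _; exact: C.
apply: (@le_trans _ _ (\sum_i \sum_j (dotv (u i) (u i) + dotv (u j) (u j)))).
  apply: ler_sum => i _; rewrite E; apply: ler_sum => j _.
  by rewrite (le_trans (ler_norm _))// dotv_young.
under eq_bigr do rewrite big_split/= sumr_const card_ord.
rewrite big_split/= sumr_const card_ord sumrMnl -mulr_sumr.
by rewrite [leRHS]mulrCA [leRHS]mulr_natl mulr2n mulr_natl.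
Qed.

End dot_product.

Lemma test_function0 (R : realType) m :
  test_function ((fun=> 0) : 'rV[R]_m -> R).
Proof.
split; last first.
  rewrite (_ : [set x | _] = set0) ?closure0; first exact: compact0.
  by apply/seteqP; split => x //=; rewrite eqxx.
move=> s x _.
have -> : pders s ((fun=> 0) : 'rV[R]_m -> R^o) = (fun=> 0).
  by elim: s => //= i s ->; apply/funext => y; exact: derive_cst.
by split=> [|i]; [exact: cst_continuous|exact: derivable_cst].
Qed.

(** * Integrability of the energy densities and consequences of stationarity *)

Section energy.
Variables (R : realType) (m q n : nat) (N : set 'rV[R]_q).
Variable phi : 'rV[R]_m -> 'rV[R]_q.
Hypotheses (hN : embedded_submanifold n N) (hW : W22_loc_map N phi).
Notation mu := (lebesgue_rV R m).
Notation tau := (tension N phi).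

(** [wpder] is chosen by [get]; the existence clauses of [Wk2_loc] ensure that the chosen function
    is a weak derivative. *)
Let mW (c : 'I_q) : [/\ measurable_fun setT (fun x => phi x ord0 c),
  forall i, is_weak_pder i (fun x => phi x ord0 c) (wpder i (fun x =>
    phi x ord0 c)),
  forall i, measurable_fun setT (wpder i (fun x => phi x ord0 c)) &
  forall i j, measurable_fun setT (wpder i (wpder j (fun x => phi x ord0 c)))].
Proof.
have [+ _] := hW => /(_ c)[[m0 _] H]; split=> // [i|i|i j].
- by have [w _] := H i; exact: getPex w.
- by have [_ [[]]] := H i.
- by have [_ [_ /(_ i)[_ [[]]]]] := H j.
Qed.

Lemma measurable_phi : measurable_fun setT phi.
Proof. by apply: measurable_rVP => c; have [] := mW c. Qed.

Lemma measurable_dphi i c : measurable_fun setT (fun x => dphi phi i x ord0 c).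
Proof.
rewrite (_ : (fun x => _) = wpder i (fun x => phi x ord0 c)).
  by have [] := mW c.
by apply/funext => x; rewrite mxE.
Qed.

(** Because [tproj N] is measurable on the whole space, composing it with [phi] needs no
    modification on the null set where [phi] leaves [N]. *)
Lemma measurable_hess i j c :
  measurable_fun setT (fun x => hess N phi i j x ord0 c).
Proof.
rewrite (_ : (fun x => _) = fun x => \sum_k
    (wpder i (wpder j (fun x => phi x ord0 k)) x * tproj N (phi x) k c)).
  apply: measurable_sum => k; apply: measurable_funM.
    by have [] := mW k.
  by apply: measurableT_comp (measurable_tproj hN k c) measurable_phi.
apply/funext => x; rewrite mxE; apply: eq_bigr => k _; rewrite mxE.
congr (wpder i _ x * _); apply/funext => y; by rewrite mxE.
Qed.

Lemma measurable_tension c : measurable_fun setT (fun x => tau x ord0 c).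
Proof.
rewrite (_ : (fun x => _) = fun x => \sum_i hess N phi i i x ord0 c).
  by apply: measurable_sum => i; exact: measurable_hess.
by apply/funext => x; rewrite summxE.
Qed.

Lemma measurable_dotv (u v : 'rV[R]_m -> 'rV[R]_q) :
  (forall c, measurable_fun setT (fun x => u x ord0 c)) ->
  (forall c, measurable_fun setT (fun x => v x ord0 c)) ->
  measurable_fun setT (fun x => dotv (u x) (v x)).
Proof. by move=> mu_ mv; apply: measurable_sum => c;
  exact: measurable_funM. Qed.

Hypothesis hE : finite_energy N phi.

Let e x := normsq_dphi phi x.
Let h x := normsq_hess N phi x.
Let t x := dotv (tau x) (tau x).
Let p i x := dotv (dphi phi i x) (tau x).

Let e0 x : 0 <= e x. Proof. by apply: sumr_ge0 => i _; exact: dotv_ge0. Qed.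
Let h0 x : 0 <= h x.
Proof. by do 2 apply: sumr_ge0 => ? _; exact: dotv_ge0. Qed.
Let t0 x : 0 <= t x. Proof. exact: dotv_ge0. Qed.

Let me : measurable_fun setT e.
Proof.
by apply: measurable_sum => i; apply: measurable_dotv => c;
  exact: measurable_dphi.
Qed.

Let mt : measurable_fun setT t.
Proof. by apply: measurable_dotv => c; exact: measurable_tension. Qed.

Let mp i : measurable_fun setT (p i).
Proof.
by apply: measurable_dotv => c;
  [exact: measurable_dphi|exact: measurable_tension].
Qed.

Let ieh : mu.-integrable setT (EFin \o (fun x => e x + h x)).
Proof.
apply/integrableP; split.
  apply/measurable_EFinP; apply: measurable_funD => //.
  apply: measurable_sum => i; apply: measurable_sum => j.
  by apply: measurable_dotv => c; exact: measurable_hess.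
move: hE; rewrite /finite_energy; apply: le_lt_trans.
by under eq_integral do rewrite gee0_abs ?lee_fin ?addr_ge0//.
Qed.

Let integrable_le (u v : 'rV[R]_m -> R) : measurable_fun setT u ->
  mu.-integrable setT (EFin \o v) -> (forall x, `|u x| <= v x) ->
  mu.-integrable setT (EFin \o u).
Proof.
move=> mu_ iv uv; apply: le_integrable iv => //; first exact/measurable_EFinP.
by move=> x _; rewrite /= lee_fin (le_trans (uv x))// ler_norm.
Qed.

Let ie : mu.-integrable setT (EFin \o e).
Proof. by apply: (integrable_le me ieh) => x; rewrite ger0_norm// lerDl. Qed.

Let it : mu.-integrable setT (EFin \o t).
Proof.
apply: (@integrable_le _ (fun x => m%:R * 2 * (e x + h x))) => //.
  rewrite (_ : EFin \o _ = (fun x => (m%:R * 2)%:E * (e x + h x)%R%:E)%E).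
    exact: integrableZl.
  by apply/funext => x; rewrite /= EFinM.
move=> x; rewrite ger0_norm// (le_trans (dotv_sum_le _))// -mulrA ler_wpM2l//.
rewrite -mulr_sumr ler_wpM2l// ler_wpDl//; apply: ler_sum => i _.
by rewrite (bigD1 i)//= lerDl sumr_ge0// => j _; exact: dotv_ge0.
Qed.

Let p_le i x : `|p i x| <= e x + t x.
Proof.
rewrite (le_trans (dotv_young _ _))// lerD2r /e /normsq_dphi (bigD1 i)//= lerDl.
by apply: sumr_ge0 => j _; exact: dotv_ge0.
Qed.

Let iet : mu.-integrable setT (EFin \o (fun x => e x + t x)).
Proof.
rewrite (_ : EFin \o _ = (EFin \o e) \+ (EFin \o t))%E.
  exact: integrableD.
by apply/funext => x; rewrite /= EFinD.
Qed.

Variables delta1 delta2 : R.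
Hypothesis stat : stationary_solution N phi delta1 delta2.

Let integrable_pder (g : 'I_m -> R -> R) : (forall i, test1 (g i)) ->
  mu.-integrable setT
    (EFin \o (fun x => \sum_i (pder i (prodf g : 'rV[R]_m -> R^o) x * p i x))).
Proof.
move=> tg.
rewrite (_ : EFin \o _ = fun x =>
    (\sum_i (pder i (prodf g : 'rV[R]_m -> R^o) x * p i x)%:E)%E); last first.
  by apply/funext => x; rewrite /= sumEFin.
apply: integrable_sum => // i _.
have tu : forall j, test1 (upd g i (derive1 (g i)) j).
  by move=> j; rewrite /upd; case: ifP => // _; exact: test1_derive.
have [C gC] := bounded_prodf tu.
rewrite pder_prodf; last by case: (tg i).
rewrite (_ : (fun x => _) = EFin \o (fun x =>
  p i x * prodf (upd g i (derive1 (g i))) x)).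
  apply: integrable_mul_bounded gC.
    by apply: integrable_le iet (p_le i).
  by apply: measurable_prodf => j; case: (tu j).
by apply/funext => x; rewrite /= mulrC.
Qed.

(* The stress-energy tensor tested against eta times the metric. *)
Let trace_identity (g : 'I_m -> R -> R) : (forall i, test1 (g i)) ->
  delta1 * ((2 - m%:R) * \int[mu]_x (e x * prodf g x)) +
  delta2 * ((4 - m%:R) * \int[mu]_x (t x * prodf g x)) +
  (4 - 2 * m%:R) * delta2 *
    \int[mu]_x \sum_i (pder i (prodf g : 'rV[R]_m -> R^o) x * p i x) = 0.
Proof.
move=> tg; have sg i : smooth1 (g i) by case: (tg i).
pose k i j : 'rV[R]_m -> R := if i == j :> 'I_m then prodf g else fun=> 0.
have kC : (fun i j => k j i) = k.
  by apply/funext => i; apply/funext => j; rewrite /k eq_sym.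
have [_ /(_ k)] := stat.
have sk : sym_tensor k.
  split=> [i j|i j]; last by rewrite /k eq_sym; case: eqP => // ->.
  by rewrite /k; case: ifP => _;
    [exact: test_function_prodf|exact: test_function0].
move=> /(_ sk).
have kD (c : 'I_m -> 'I_m -> R) x :
    \sum_i \sum_j k i j x * c i j = prodf g x * \sum_i c i i.
  rewrite mulr_sumr; apply: eq_bigr => i _; rewrite (bigD1 i)//= big1 ?addr0.
    by rewrite /k eqxx.
  by move=> j ji; rewrite /k eq_sym (negPf ji) mul0r.
have trk : trace_tensor k = fun x => m%:R * prodf g x.
  apply/funext => x; rewrite /trace_tensor /k.
  under eq_bigr do rewrite eqxx.
  by rewrite sumr_const card_ord mulr_natl.
have [C gC] := bounded_prodf tg; have mg := measurable_prodf sg.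
have ieg := integrable_mul_bounded ie mg gC.
have itg := integrable_mul_bounded it mg gC.
have T1 : \int[mu]_x \sum_i \sum_j k i j x * (2 * dotv (dphi phi i x) (dphi phi
  j x)
    - (i == j)%:R * normsq_dphi phi x) = (2 - m%:R) * \int[mu]_x (e x * prodf g
        x).
  rewrite -RintegralZl//; apply: eq_Rintegral => x _; rewrite kD.
  under eq_bigr do rewrite eqxx mul1r.
  by rewrite sumrB -mulr_sumr sumr_const card_ord -mulr_natl -/(normsq_dphi phi
    x) /e; ring.
have T2 : \int[mu]_x (trace_tensor k x * dotv (tau x) (tau x)) =
    m%:R * \int[mu]_x (t x * prodf g x).
  rewrite -RintegralZl//; apply: eq_Rintegral => x _.
  by rewrite trk -/(t x); ring.
pose D := \int[mu]_x \sum_i (pder i (prodf g : 'rV[R]_m -> R^o) x * p i x).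
have iD : mu.-integrable setT
    (EFin \o (fun x => \sum_i (pder i (prodf g : 'rV[R]_m -> R^o) x * p i x))).
  exact: integrable_pder.
have T3 : pair_div_dphi_tau N phi k = - (m%:R * D).
  rewrite /pair_div_dphi_tau /D -RintegralZl//; congr (- _).
  apply: eq_Rintegral => x _; rewrite mulr_sumr; apply: eq_bigr => i _.
  rewrite trk mulrA; congr (_ * _); rewrite /pder.
  have [dg _] := is_derive_prodf x (sg i).
  by rewrite (_ : (fun x => _) = m%:R \*: (prodf g : 'rV[R]_m -> R^o))//
    deriveZ.
have T4 : pair_dphi_nabla_tau N phi k = - D - \int[mu]_x (t x * prodf g x).
  rewrite /pair_dphi_nabla_tau; congr (- _ - _); apply: eq_Rintegral => x _.
    apply: eq_bigr => i _; rewrite (bigD1 i)//= big1 ?addr0 => [|j ji].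
      by rewrite /k eqxx.
    by rewrite /k eq_sym (negPf ji) /pder derive_cst mul0r.
  by rewrite kD dotv_suml mulrC.
(* The two symmetric pairings, weighted by -2 delta2, contribute 4 INT eta |tau|^2 and 4 [D]; the
   trace part contributes - m INT eta |tau|^2 and - 2 m [D]. *)
rewrite /stress_pairing kC T1 T2 T3 T4 -/D => st.
by rewrite -[RHS]st; ring.
Qed.

Let trace_limit :
  delta1 * ((2 - m%:R) * \int[mu]_x e x) +
  delta2 * ((4 - m%:R) * \int[mu]_x t x) = 0.
Proof.
pose r : R -> R := plateau (-1) 1 1.
have tr : test1 r by apply: plateau_test; lra.
have sr : smooth1 r by case: tr.
(* These scales are positive and at most 1, so the bound on the gradient term by [a k] times a
   constant also yields a dominating function independent of [k]. *)
pose a k : R := k.+1%:R^-1.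
have a0 k : 0 < a k by rewrite invr_gt0.
have a1 k : a k <= 1 by rewrite invf_le1// ler1n.
have acvg : a k @[k --> \oo] --> (0 : R) by exact: cvg_harmonic.
pose g k (i : 'I_m) (s : R) : R := r (a k * s).
have tg k i : test1 (g k i) by exact: test1_scale.
have sg k i : smooth1 (g k i) by case: (tg k i).
(* The cutoffs tend pointwise to r(0)^m rather than to 1; being positive, this constant is cancelled
   at the end. *)
pose c : R := \prod_(i < m) r 0.
have c0 : 0 < c.
  apply: prodr_gt0 => i _; rewrite /r plateauE.
  by rewrite ifT ?expR_gt0// !(mul1r, opprK, add0r, subr0, mulr1).
have gc x : prodf (g k) x @[k --> \oo] --> c.
  apply: cvg_big => [|i _]; first exact: mul_continuous.
  apply: (@cvg_comp _ _ _ (fun k => a k * x ord0 i) r _ (nbhs (0 : R))).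
    by rewrite -(mul0r (x ord0 i)); apply: cvgMr_tmp.
  exact: smooth1_continuous.
have gle k x : `|prodf (g k) x| <= 1.
  rewrite normr_prod; apply: prodr_ile1 => i _.
  by rewrite normr_ge0 plateau_bounded.
have [C rC] := test1_bounded (test1_derive tr).
have C0 : 0 <= C by rewrite (le_trans _ (rC 0)).
have dle k i x : `|pder i (prodf (g k) : 'rV[R]_m -> R^o) x| <= a k * C.
  rewrite pder_prodf; last exact: sg.
  rewrite prodf_upd normrM.
  rewrite (derive1_is_derive (fun s => is_derive_scale (a k) s sr)).
  rewrite -[leRHS]mulr1 ler_pM//.
    by rewrite normrM gtr0_norm// ler_wpM2l// ltW.
  rewrite normr_prod; apply: prodr_ile1 => j _.
  by rewrite normr_ge0 plateau_bounded.
have cA : \int[mu]_x (e x * prodf (g k) x) @[k --> \oo] --> \int[mu]_x (e x *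
  c).
  exact: (cvg_Rintegral_mul ie (fun k => measurable_prodf (sg k))
    (measurable_cst c) gle gc).
have cB : \int[mu]_x (t x * prodf (g k) x) @[k --> \oo] --> \int[mu]_x (t x *
  c).
  exact: (cvg_Rintegral_mul it (fun k => measurable_prodf (sg k))
    (measurable_cst c) gle gc).
have cD : \int[mu]_x \sum_i (pder i (prodf (g k) : 'rV[R]_m -> R^o) x * p i x)
    @[k --> \oo] --> \int[mu]_x (0 : R).
  apply: (@cvg_Rintegral_dominated _ _ _ _ _ _ (fun x =>
    (m%:R * C) * (e x + t x))) => //.
  - by move=> k; apply/measurable_EFinP;
      exact: measurable_int (integrable_pder (tg k)).
  - rewrite (_ : EFin \o _ = (fun x => (m%:R * C)%:E * (e x + t x)%R%:E)%E).
      exact: integrableZl.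
    by apply/funext => x; rewrite /= EFinM.
  - move=> k x; rewrite (le_trans (ler_norm_sum _ _ _))//.
    rewrite (@le_trans _ _ (\sum_(i < m) C * (e x + t x)))//.
      apply: ler_sum => i _; rewrite normrM ler_pM ?p_le//.
      by rewrite (le_trans (dle k i x))// ler_piMl.
    by rewrite sumr_const card_ord -mulrA mulr_natl.
  - move=> x.
    have : \sum_i (pder i (prodf (g k) : 'rV[R]_m -> R^o) x * p i x)
        @[k --> \oo] --> \sum_(i < m) (0 * p i x).
      apply: cvg_big => [|i _]; first exact: add_continuous.
      apply: cvgMr_tmp; apply/norm_cvg0P.
      apply: (@squeeze_cvgr _ _ _ _ (fun=> 0) (fun k => a k * C)).
      + by apply: nearW => k; rewrite normr_ge0 dle.
      + exact: cvg_cst.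
      + by rewrite -(mul0r C); apply: cvgMr_tmp.
    by under eq_bigr do rewrite mul0r; rewrite big1.
have := cvgD (cvgD (cvgMl_tmp (a := delta1) (cvgMl_tmp (a := 2 - m%:R) cA))
  (cvgMl_tmp (a := delta2) (cvgMl_tmp (a := 4 - m%:R) cB)))
  (cvgMl_tmp (a := (4 - 2 * m%:R) * delta2) cD).
rewrite (_ : (_ + _ + _ : nat -> R) = cst 0); last first.
  by apply/funext => k; exact: trace_identity.
move=> H; have := cvg_lim (@Rhausdorff R) (H _ _ _ _ _ _ _).
rewrite lim_cst; last exact: Rhausdorff.
move=> /(_ _ _ _ _ _ _ _ _)/esym.
rewrite !RintegralZr// Rintegral_cst// mul0r mulr0 addr0 => /eqP.
have -> : delta1 * ((2 - m%:R) * (\int[mu]_x e x * c)) +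
    delta2 * ((4 - m%:R) * (\int[mu]_x t x * c)) =
    (delta1 * ((2 - m%:R) * \int[mu]_x e x) +
    delta2 * ((4 - m%:R) * \int[mu]_x t x)) * c by ring.
by rewrite mulf_eq0 (gt_eqF c0) orbF => /eqP.
Qed.

Let Rint_eq0 (u : 'rV[R]_m -> R) : mu.-integrable setT (EFin \o u) ->
  (forall x, 0 <= u x) -> \int[mu]_x u x = 0 -> \forall x \ae mu, u x = 0.
Proof.
move=> iu u0 I0.
have : ae_eq mu setT (EFin \o u) (cst 0%E).
  apply/ae_eq_integral_abs => //; first exact: measurable_int iu.
  under eq_integral do rewrite /= ger0_norm//.
  rewrite -[LHS]fineK; last exact: integrable_fin_num.
  by rewrite -[fine _]/(Rintegral _ _ _) I0.
by apply: filterS => x /(_ Logic.I) [].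
Qed.

Lemma harmonic_of_tension0 : \int[mu]_x t x = 0 -> harmonic_map N phi.
Proof.
by move=> /(Rint_eq0 it t0); apply: filterS => x; exact: dotv_eq0.
Qed.

Lemma trivial_of_dphi0 : (0 < m)%N -> \int[mu]_x e x = 0 -> trivial_map phi.
Proof.
move=> m0 /(Rint_eq0 ie e0) ae0.
have dz i c : \forall x \ae mu, wpder i (fun y => phi y ord0 c) x = 0.
  apply: filterS ae0 => x /eqP; rewrite psumr_eq0 => [/allP ex|j _];
    last exact: dotv_ge0.
  have /eqP/dotv_eq0/rowP/(_ c) := ex i (mem_index_enum i).
  by rewrite !mxE.
have cst_ c : exists z, \forall x \ae mu, phi x ord0 c = z.
  have [_ W mw _] := mW c.
  (* Local integrability of the components of [phi] is part of [is_weak_pder], so one index has to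
     exist; [0 < m] provides it. *)
  apply: zero_weak_gradient => [|i g tg]; first by have [] := W (Ordinal m0).
  have [_ _ ->] := W i; last exact: test_function_prodf.
  apply/eqP; rewrite oppr_eq0 /Rintegral; apply/eqP.
  rewrite (ae_eq_integral (cst 0%E)) ?integral0//.
  - apply/measurable_EFinP; apply: measurable_funM => //.
    by apply: measurable_prodf => k; case: (tg k).
  - by apply: filterS (dz i c) => x wx _; rewrite wx mul0r.
have /all_sig[z zP] c : {z | \forall x \ae mu, phi x ord0 c = z} by exact: cid.
exists (\row_c z c).
have : \forall x \ae mu, forall c, phi x ord0 c = z c.
  exact: filter_forall.
by apply: filterS => x xz; apply/rowP => c; rewrite mxE.
Qed.

(** With E = INT |dphi|^2 and T = INT |tau|^2, both nonnegative, the limit identity reads delta1 E +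
    3 delta2 T = 0 for m = 1, 2 delta2 T = 0 for m = 2, - delta1 E + delta2 T = 0 for m = 3 and - 2
    delta1 E = 0 for m = 4. For m >= 5 both coefficients are positive. *)
Lemma stationary_cases :
  [/\ m = 1%N -> 0 < delta1 -> 0 < delta2 -> trivial_map phi,
      m = 2%N -> delta2 != 0 -> harmonic_map N phi,
      m = 3%N -> delta1 < 0 -> 0 < delta2 -> trivial_map phi,
      m = 4%N -> delta1 < 0 -> trivial_map phi &
      (5 <= m)%N -> delta1 < 0 -> delta2 < 0 -> trivial_map phi].
Proof.
have := trace_limit; set E := \int[mu]_x e x; set T := \int[mu]_x t x => ET.
have E0 : 0 <= E by apply: Rintegral_ge0 => x _; exact: e0.
have T0 : 0 <= T by apply: Rintegral_ge0 => x _; exact: t0.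
split.
- by move=> m1 d1 d2; apply: trivial_of_dphi0; rewrite ?m1//; move: ET;
    rewrite -/E m1; nra.
- move=> m2 d2; apply: harmonic_of_tension0; move: ET; rewrite -/T m2.
  by rewrite subrr mul0r mulr0 add0r => /eqP; rewrite !mulf_eq0 (negPf d2)/= =>
    /orP[|/eqP//]; lra.
- by move=> m3 d1 d2; apply: trivial_of_dphi0; rewrite ?m3//; move: ET;
    rewrite -/E m3; nra.
- by move=> m4 d1; apply: trivial_of_dphi0; rewrite ?m4//; move: ET;
    rewrite -/E m4; nra.
- move=> m5 d1 d2; apply: trivial_of_dphi0; first exact: leq_trans m5;
    move: ET; rewrite -/E.
  have : 5 <= m%:R :> R by rewrite ler_nat.
  move: (m%:R : R) => M M5 ET.
  have p1 : 0 < delta1 * (2 - M) by nra.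
  have p2 : 0 < delta2 * (4 - M) by nra.
  have q1 := mulr_ge0 (ltW p1) E0; have q2 := mulr_ge0 (ltW p2) T0.
  have /eqP : delta1 * (2 - M) * E = 0 by lra.
  by rewrite mulf_eq0 (gt_eqF p1) => /eqP.
Qed.

End energy.

Theorem theorem3p2 (R : realType) (m q n : nat) (N : set 'rV[R]_q)
    (delta1 delta2 : R) (phi : 'rV[R]_m -> 'rV[R]_q)
    (hN : embedded_submanifold n N)
    (hdelta1 : delta1 != 0) (hdelta2 : delta2 != 0)
    (hW22 : W22_loc_map N phi) (hLinfty : Linfty_loc phi)
    (hstat : stationary_solution N phi delta1 delta2)
    (henergy : finite_energy N phi) :
  [/\ m = 1%N -> 0 < delta1 -> 0 < delta2 -> trivial_map phi,
      m = 2%N -> 0 < delta2 -> harmonic_map N phi,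
      m = 3%N -> delta1 < 0 -> 0 < delta2 -> trivial_map phi,
      m = 4%N -> delta1 < 0 -> trivial_map phi &
      (5 <= m)%N -> delta1 < 0 -> delta2 < 0 -> trivial_map phi].
Proof.
have [c1 c2 c3 c4 c5] := stationary_cases hN hW22 henergy hstat.
by split=> // m2 _; exact: c2.
Qed.
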